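(* The following statements are true. 1. $\mathrm{I}(\Theta)=\Gamma(\mathbb{R})*\mathrm{M}^1(\mathbb{Z}(2))$. 2. For a distribution $\mu\in\mathrm{M}^1(\mathbb{R}\times\mathbb{Z}(2))$: $\mu\in\mathrm{I}_0(\Theta)$ if and only if $\mu\in\Gamma(\mathbb{R})*\mathrm{M}^1(\mathbb{Z}(2))$ and $\mu$ cannot be represented as $\mu=\gamma*m_{\mathbb{Z}(2)}$, where $\gamma$ is a nondegenerate Gaussian distribution on the group $\mathbb{R}$. 3. For a distribution $\mu\in\mathrm{M}^1(\mathbb{R}\times\mathbb{Z}(2))$: $\mu\in\mathrm{Ind}(\Theta)$ if and only if there are real numbers $\sigma,\sigma',\beta,\beta',\kappa$ such that the characteristic function $\hat\mu(s,l)$ is represented in the form $$ \hat\mu(s, l) = \begin{cases}\exp\{-\sigma s^2+i\beta s\}, & s\in \mathbb{R},\ l=0,\\ \kappa\exp\{-\sigma' s^2+i\beta's\}, & s\in \mathbb{R},\ l=1,\end{cases} $$ and $$ 0<\sigma'<\sigma, \qquad |\kappa|=\sqrt{\frac{\sigma'}{\sigma}}\,\exp\left\{-\frac{(\beta-\beta')^2}{4(\sigma-\sigma')}\right\}. $$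
   Context: $\mathbb{Z}(2)=\{0,1\}$ is the additive group of integers modulo 2. For a locally compact Abelian group $X$, $\mathrm{M}^1(X)$ is the convolution semigroup of all distributions (probability measures) on $X$. Elements of $\mathbb{R}\times\mathbb{Z}(2)$ are written $(t,k)$; the character group of $\mathbb{R}\times\mathbb{Z}(2)$ is identified with $\mathbb{R}\times\mathbb{Z}(2)$, with elements $(s,l)$ and pairing $((t,k),(s,l))=e^{its}(-1)^{kl}$. The characteristic function of $\mu\in\mathrm{M}^1(\mathbb{R}\times\mathbb{Z}(2))$ is $\hat\mu(s,l)=\int e^{its}(-1)^{kl}\,d\mu(t,k)$. $E_x$ denotes the distribution concentrated at the point $x$; such distributions are called degenerate. $\Gamma(\mathbb{R})$ is the set of Gaussian distributions on $\mathbb{R}$, i.e. distributions with characteristic function $\exp\{-\sigma s^2+i\beta s\}$, $\sigma\ge 0$, $\beta\in\mathbb{R}$ (degenerate ones, $\sigma=0$, are included). $m_{\mathbb{Z}(2)}$ is the Haar (uniform) distribution on $\mathbb{Z}(2)$. The groups $\mathbb{R}$ and $\mathbb{Z}(2)$ are considered as subgroups of $\mathbb{R}\times\mathbb{Z}(2)$, and distributions on them are regarded as distributions on $\mathbb{R}\times\mathbb{Z}(2)$; $\Gamma(\mathbb{R})*\mathrm{M}^1(\mathbb{Z}(2))$ is the set of all $\gamma*\omega$ with $\gamma\in\Gamma(\mathbb{R})$, $\omega\in\mathrm{M}^1(\mathbb{Z}(2))$. The class $\Theta$ consists of all distributions $\mu$ on $\mathbb{R}\times\mathbb{Z}(2)$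 whose characteristic function is of the form $\hat\mu(s,0)=\exp\{-\sigma s^2+i\beta s\}$, $\hat\mu(s,1)=\kappa\exp\{-\sigma's^2+i\beta's\}$, $s\in\mathbb{R}$, where $\sigma\ge 0$, $\sigma'\ge 0$ and $\beta,\beta',\kappa$ are real numbers such that either (i) $0<\sigma'<\sigma$ and $0<|\kappa|\le\sqrt{\sigma'/\sigma}\,\exp\{-(\beta-\beta')^2/(4(\sigma-\sigma'))\}$, or (ii) $\sigma=\sigma'$, $\beta=\beta'$, $|\kappa|\le 1$. The class $\Theta$ is a semigroup under convolution and contains all degenerate distributions. Definitions in the semigroup $\Theta$: for $\mu\in\Theta$, a distribution $\mu_1\in\Theta$ is a factor of $\mu$ if $\mu=\mu_1*\mu_2$ for some $\mu_2\in\Theta$. A nondegenerate $\mu\in\Theta$ is indecomposable if its only factors are degenerate distributions and shifts $\mu*E_x$ of $\mu$. A distribution $\mu\in\Theta$ is infinitely divisible if for each natural $n$ there are $\mu_n\in\Theta$ and $x_n\in\mathbb{R}\times\mathbb{Z}(2)$ such that $\mu=\mu_n^{*n}*E_{x_n}$. $\mathrm{I}(\Theta)$ is the class of infinitely divisible distributions, $\mathrm{I}_0(\Theta)$ the class of distributions which have no indecomposable factors, and $\mathrm{Ind}(\Theta)$ the class of indecomposable distributions, in the semigroup $\Theta$. *)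

(* Defs.v *)
From HB Require Import structures.
From mathcomp Require Import all_boot all_order all_algebra.
From mathcomp Require Import all_classical all_reals all_analysis.
From mathcomp Require Import measurable_realfun.
From mathcomp Require Export complex giry.

Set Implicit Arguments.
Unset Strict Implicit.
Unset Printing Implicit Defensive.

Import Order.TTheory GRing.Theory Num.Theory.
Import numFieldNormedType.Exports.

Local Open Scope classical_set_scope.
Local Open Scope ring_scope.
Local Open Scope complex_scope.

Section Distributions.
Context d (T : measurableType d) (R : realType).

(* Equality of distributions is the library's [≡μ], equality on measurable
   sets: a [probability] is a function on all of [set T] whose values on
   nonmeasurable sets are unconstrained, so Leibniz equality is too strong. *)
Definition degenerate (mu : probability T R) : Prop :=
  exists x : T, mu ≡μ (\d_x : probability T R).

Definition cintegral (mu : probability T R) (f : T -> R[i]) : R[i] :=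
  Rintegral mu setT (fun x => complex.Re (f x)) +i*
  Rintegral mu setT (fun x => complex.Im (f x)).

End Distributions.

(* Z(2) is [bool] with its library group structure: + is exclusive or and 0 is
   [false]. R * Z(2) is the product group with the product sigma-algebra. *)
Notation RZ2 R := (R * bool)%type.

Section RZ2Maps.
Context (R : realType).

Definition addRZ2 (x : RZ2 R * RZ2 R) : RZ2 R := x.1 + x.2.
(* The subgroup embeddings of R and Z(2), used to regard distributions on
   either subgroup as distributions on R * Z(2). *)
Definition injR (t : R) : RZ2 R := (t, 0).
Definition injZ2 (k : bool) : RZ2 R := (0, k).

Lemma measurable_addRZ2 : measurable_fun setT addRZ2.
Proof.
apply/measurable_fun_pairP; split.
  by apply: measurable_funD; apply: measurableT_comp => //.
have -> : snd \o addRZ2 =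
    (fun x => x.1.2 && ~~ x.2.2 || ~~ x.1.2 && x.2.2).
  by apply/funext => -[[t []] [u []]].
by apply: measurable_or; apply: measurable_and; do ?apply: measurable_neg;
  apply: measurableT_comp.
Qed.

Lemma measurable_injR : measurable_fun setT injR.
Proof. exact: measurable_fun_pair. Qed.

Lemma measurable_injZ2 : measurable_fun setT injZ2.
Proof. exact: measurable_fun_pair. Qed.

HB.instance Definition _ := isMeasurableFun.Build _ _ _ _ addRZ2 measurable_addRZ2.
HB.instance Definition _ := isMeasurableFun.Build _ _ _ _ injR measurable_injR.
HB.instance Definition _ := isMeasurableFun.Build _ _ _ _ injZ2 measurable_injZ2.

End RZ2Maps.

Section Classes.
Context (R : realType).
Local Notation M1 := (probability (RZ2 R) R).
Implicit Types (mu nu : M1) (S : set M1).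

Definition convol mu nu : M1 := distribution (mu \x nu)%E (@addRZ2 R).

Fixpoint convol_pow mu (n : nat) : M1 :=
  if n is m.+1 then convol (convol_pow mu m) mu else \d_(0 : RZ2 R).

Definition ofR (gamma : probability R R) : M1 := distribution gamma (@injR R).
Definition ofZ2 (omega : probability bool R) : M1 := distribution omega (@injZ2 R).

Definition haarZ2 : probability bool R := bernoulli_prob (2^-1 : R).

Definition cexp (z : R[i]) : R[i] :=
  (expR (complex.Re z))%:C * (cos (complex.Im z) +i* sin (complex.Im z)).

Definition chfR (gamma : probability R R) (s : R) : R[i] :=
  cintegral gamma (fun t => cexp (0 +i* (t * s))).

Definition chf mu (s : R) (l : bool) : R[i] :=
  cintegral mu (fun x => cexp (0 +i* (x.1 * s)) * (-1) ^+ (x.2 * l)%N).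

Definition gauss_chf (sigma beta s : R) : R[i] :=
  cexp ((- (sigma * s ^+ 2)) +i* (beta * s)).

Definition gaussian (gamma : probability R R) : Prop :=
  exists sigma beta : R, 0 <= sigma /\
    forall s, chfR gamma s = gauss_chf sigma beta s.

Definition theta_chf (sigma sigma' beta beta' kappa : R) (s : R) (l : bool)
    : R[i] :=
  if l then kappa%:C * gauss_chf sigma' beta' s else gauss_chf sigma beta s.

Definition Theta : set M1 := [set mu |
  exists sigma sigma' beta beta' kappa : R,
  [/\ 0 <= sigma, 0 <= sigma',
      (forall s l, chf mu s l = theta_chf sigma sigma' beta beta' kappa s l) &
      (0 < sigma' < sigma /\
        0 < `|kappa| <= Num.sqrt (sigma' / sigma) *
          expR (- ((beta - beta') ^+ 2 / (4 * (sigma - sigma'))))) \/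
      [/\ sigma = sigma', beta = beta' & `|kappa| <= 1] ]].

Definition gauss_convol_M1Z2 : set M1 := [set mu |
  exists (gamma : probability R R) (omega : probability bool R),
    gaussian gamma /\ mu ≡μ convol (ofR gamma) (ofZ2 omega)].

Definition is_factor S mu mu1 : Prop :=
  S mu1 /\ exists mu2, S mu2 /\ mu ≡μ convol mu1 mu2.

Definition is_shift mu nu : Prop :=
  exists x : RZ2 R, nu ≡μ convol mu \d_x.

Definition Ind S : set M1 := [set mu |
  [/\ S mu, ~ degenerate mu &
      forall mu1, is_factor S mu mu1 -> degenerate mu1 \/ is_shift mu mu1]].

Definition InfDiv S : set M1 := [set mu |
  S mu /\ forall n : nat, (0 < n)%N ->
    exists (mu_n : M1) (x_n : RZ2 R),
      S mu_n /\ mu ≡μ convol (convol_pow mu_n n) \d_x_n].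

Definition I0 S : set M1 := [set mu |
  S mu /\ ~ exists2 mu1, is_factor S mu mu1 & Ind S mu1].

End Classes.

Arguments Theta {R}.
Arguments haarZ2 {R}.
Arguments gauss_convol_M1Z2 {R}.

(* Main.v *)
From HB Require Import structures.
Require Import Defs.
From mathcomp Require Import all_boot all_order all_algebra.
From mathcomp Require Import all_classical all_reals all_analysis.
From mathcomp Require Import measurable_realfun.
From mathcomp Require Import complex giry.
From mathcomp Require Import ring lra.

Set Implicit Arguments.
Unset Strict Implicit.
Unset Printing Implicit Defensive.

Import Order.TTheory GRing.Theory Num.Theory.
Import numFieldNormedType.Exports.
Local Open Scope classical_set_scope.
Local Open Scope ring_scope.

(** The class Theta is governed by five real parameters [sigma], [sigma'], [beta],
    [beta'], [kappa]. Characteristic functions determine laws on [R * Z(2)]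
    ([chf_inj]), so a law of Theta is known from its parameters; convolution adds
    the four Gaussian parameters and multiplies the [kappa]s ([theta_lawM]); and the
    parameters can be read off the characteristic function ([theta_chf_inj]), except
    that [sigma'] and [beta'] are lost when [kappa = 0]. Once every admissible
    parameter is known to occur ([theta_exists]), the theorem is a statement about
    parameters.

    Two facts are analytic. Uniqueness is proved by Gaussian smoothing: a normal
    density is an average of cosines ([Rintegral_normal_cos]), so that the smoothed
    measures are functions of the characteristic function, and the measures of rays
    are limits of smoothed measures. Existence for unequal variances
    ([theta_exists_lt]) comes from the density [1 + (-1) ^+ k * kappa * r t] with
    respect to a normal law times the Haar law, where [r] is the ratio of the two
    normal densities; the bound imposed on [kappa] in Theta, called [theta_bound]
    below, is what makes this density nonnegative.

    The rest compares bounds. The bound of a convolution strictly exceeds the product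
    of the bounds of two factors of unequal variances ([theta_bound_mul_lt]), and it
    strictly increases when a common positive variance is added
    ([theta_bound_add_lt]). Hence an extreme law, one with [kappa] of maximal modulus, splits only
    into itself and degenerate factors ([theta_law_Ind]); any other nondegenerate law
    of Theta loses a two-point or a Gaussian factor ([Ind_theta_law]). If [mu] with
    unequal variances were infinitely divisible, its n-th roots would have the same
    ratio of variances and would force [kappa] to decay geometrically in n
    ([InfDiv_gauss_convol]). Finally, a law of unequal variances always has an extreme
    factor, while in a law of equal variances with [kappa != 0] every factor has equal
    variances and is thus decomposable or degenerate. If [kappa = 0] and
    [sigma > 0], the second variance can be chosen at will and an extreme factor
    reappears: these are the laws Gaussian times Haar that are excluded from the
    description of [I0 Theta]. *)

(** * Bounded measurable functions and characteristic functions *)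

(** Every integrand met against a probability is of this kind, which settles all
    integrability conditions at once. *)
Definition bounded_mfun d (T : measurableType d) (R : realType) (f : T -> R) :=
  measurable_fun setT f /\ exists M, forall x, `|f x| <= M.

Section BoundedMeasurable.
Context d (T : measurableType d) (R : realType).
Implicit Types (f g : T -> R).

Lemma bounded_mfun_cst (c : R) : bounded_mfun (fun _ : T => c).
Proof. by split; [exact: measurable_cst|exists `|c|]. Qed.

Lemma bounded_mfunD f g : bounded_mfun f -> bounded_mfun g ->
  bounded_mfun (fun x => f x + g x).
Proof.
move=> [mf [M fM]] [mg [N gN]]; split; first exact: measurable_funD.
exists (M + N) => x; exact: (le_trans (ler_normD _ _) (lerD (fM x) (gN x))).
Qed.

Lemma bounded_mfunM f g : bounded_mfun f -> bounded_mfun g ->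
  bounded_mfun (fun x => f x * g x).
Proof.
move=> [mf [M fM]] [mg [N gN]]; split; first exact: measurable_funM.
by exists (M * N) => x; rewrite normrM ler_pM.
Qed.

Lemma bounded_mfunZ (c : R) f : bounded_mfun f -> bounded_mfun (fun x => c * f x).
Proof. by apply: bounded_mfunM; exact: bounded_mfun_cst. Qed.

Lemma bounded_mfun_integrable (P : probability T R) f :
  bounded_mfun f -> P.-integrable setT (EFin \o f).
Proof.
move=> [mf [M fM]]; apply: measurable_bounded_integrable => //.
  by rewrite (le_lt_trans (probability_le1 P measurableT)) ?ltry.
by exists M; split; [exact: num_real|move=> N MN x _; exact: (le_trans (fM x) (ltW MN))].
Qed.

End BoundedMeasurable.

Lemma bounded_mfun_comp d1 d2 (T1 : measurableType d1) (T2 : measurableType d2)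
    (R : realType) (h : T1 -> T2) (f : T2 -> R) :
  measurable_fun setT h -> bounded_mfun f -> bounded_mfun (f \o h).
Proof.
by move=> mh [mf [M fM]]; split; [exact: measurableT_comp|exists M => x; exact: fM].
Qed.

Lemma measurable_cos (R : realType) : measurable_fun setT (@cos R).
Proof. by apply: continuous_measurable_fun; exact: continuous_cos. Qed.

Lemma measurable_sin (R : realType) : measurable_fun setT (@sin R).
Proof. by apply: continuous_measurable_fun; exact: continuous_sin. Qed.

Lemma bounded_mfun_cos (R : realType) : bounded_mfun (@cos R).
Proof.
split; first exact: measurable_cos.
by exists 1 => x; rewrite ler_norml cos_geN1 cos_le1.
Qed.

Lemma bounded_mfun_sin (R : realType) : bounded_mfun (@sin R).
Proof.
split; first exact: measurable_sin.
by exists 1 => x; rewrite ler_norml sin_geN1 sin_le1.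
Qed.

Section RealIntegrals.
Context d1 d2 (T1 : measurableType d1) (T2 : measurableType d2) (R : realType).

Lemma eq_measure_Rintegral (m1 m2 : {measure set T1 -> \bar R}) (f : T1 -> R) :
  (forall A, measurable A -> m1 A = m2 A) ->
  \int[m1]_x f x = \int[m2]_x f x.
Proof.
by move=> m12; congr fine; apply: eq_measure_integral => A mA _; exact: m12.
Qed.

Lemma Rintegral_distribution (P : probability T1 R) (X : {mfun T1 >-> T2}) f :
  bounded_mfun f ->
  \int[distribution P X]_y f y = \int[P]_x f (X x).
Proof.
move=> bf; congr fine; rewrite integral_distribution//.
  by apply/measurable_EFinP; case: bf.
exact: (bounded_mfun_integrable P (bounded_mfun_comp (measurable_funP X) bf)).
Qed.

Lemma Rintegral_dirac (a : T1) (f : T1 -> R) : measurable_fun setT f ->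
  \int[\d_a]_x f x = f a.
Proof.
move=> mf; rewrite /Rintegral integral_dirac//; last exact/measurable_EFinP.
by rewrite diracE in_setT mul1e.
Qed.

Lemma Rintegral_prod (P : probability T1 R) (Q : probability T2 R) f :
  bounded_mfun f ->
  \int[(P \x Q)%E]_z f z = \int[P]_x (\int[Q]_y f (x, y)).
Proof.
move=> bf; rewrite /Rintegral -integral12_prod_meas1; last first.
  exact: (bounded_mfun_integrable ((P \x Q)%E : probability (T1 * T2)%type R) bf).
congr fine; apply: eq_integral => x _; rewrite fineK//.
apply: integrable_fin_num => //.
apply: (bounded_mfun_integrable Q (f := fun y => f (x, y))).
by apply: (bounded_mfun_comp (h := pair x)) => //; exact: measurable_pair1.
Qed.

Lemma Rintegral_prodM (P : probability T1 R) (Q : probability T2 R) f g :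
  bounded_mfun f -> bounded_mfun g ->
  \int[(P \x Q)%E]_z (f z.1 * g z.2) = (\int[P]_x f x) * (\int[Q]_y g y).
Proof.
move=> bf bg; rewrite Rintegral_prod; last first.
  by apply: bounded_mfunM; [apply: (bounded_mfun_comp (h := fst))|
    apply: (bounded_mfun_comp (h := snd))].
rewrite -RintegralZr//; last exact: bounded_mfun_integrable.
apply: eq_Rintegral => x _ /=.
by rewrite RintegralZl//; exact: bounded_mfun_integrable.
Qed.

End RealIntegrals.

Section CharacteristicFunction.
Context (R : realType).
Local Notation M1 := (probability (RZ2 R) R).
Implicit Types (mu nu : M1) (s : R) (l : bool).

Lemma cexpi (y : R) : cexp (0 +i* y)%C = (cos y +i* sin y)%C.
Proof.
rewrite /cexp/= expR0.
by apply/eqP; rewrite eq_complex /=; apply/andP; split; apply/eqP; ring.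
Qed.

Definition character_re s l (x : RZ2 R) : R :=
  cos (x.1 * s) * (-1) ^+ (x.2 * l)%N.
Definition character_im s l (x : RZ2 R) : R :=
  sin (x.1 * s) * (-1) ^+ (x.2 * l)%N.

Lemma characterE s l (x : RZ2 R) :
  cexp (0 +i* (x.1 * s))%C * (-1) ^+ (x.2 * l)%N =
  (character_re s l x +i* character_im s l x)%C.
Proof.
rewrite cexpi /character_re /character_im.
by case: (x.2); case: l; rewrite /= ?mulr1 ?mulrN1 //; apply/eqP; rewrite eq_complex /= ?eqxx.
Qed.

Lemma bounded_mfun_sign (l : bool) :
  bounded_mfun (fun x : RZ2 R => (-1) ^+ (x.2 * l)%N : R).
Proof.
apply: (bounded_mfun_comp (h := snd) (f := fun k : bool => (-1) ^+ (k * l)%N : R)) => //.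
by split => //; exists 1 => k; rewrite normrX normrN1 expr1n.
Qed.

Lemma bounded_mfun_re s l : bounded_mfun (character_re s l).
Proof.
apply: bounded_mfunM; last exact: bounded_mfun_sign.
apply: (bounded_mfun_comp (f := @cos R)); last exact: bounded_mfun_cos.
exact: measurable_funM.
Qed.

Lemma bounded_mfun_im s l : bounded_mfun (character_im s l).
Proof.
apply: bounded_mfunM; last exact: bounded_mfun_sign.
apply: (bounded_mfun_comp (f := @sin R)); last exact: bounded_mfun_sin.
exact: measurable_funM.
Qed.

Lemma chfE mu s l : chf mu s l =
  ((\int[mu]_x character_re s l x) +i* (\int[mu]_x character_im s l x))%C.
Proof.
by rewrite /chf /cintegral; congr (_ +i* _)%C; apply: eq_Rintegral => x _;
  rewrite characterE.
Qed.

Lemma chf_measure_eq mu nu : mu ≡μ nu -> chf mu = chf nu.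
Proof.
move=> mn; apply/funext => s; apply/funext => l; rewrite !chfE.
by congr (_ +i* _)%C; apply: eq_measure_Rintegral.
Qed.

Lemma character_reD s l (x y : RZ2 R) : character_re s l (x + y) =
  character_re s l x * character_re s l y - character_im s l x * character_im s l y.
Proof.
rewrite /character_re /character_im /= mulrDl cosD.
by move: x y => [t [|]] [u [|]]; case: l => /=; ring.
Qed.

Lemma character_imD s l (x y : RZ2 R) : character_im s l (x + y) =
  character_re s l x * character_im s l y + character_im s l x * character_re s l y.
Proof.
rewrite /character_re /character_im /= mulrDl sinD.
by move: x y => [t [|]] [u [|]]; case: l => /=; ring.
Qed.

(** The characters are multiplicative; since they are kept as pairs of real
    functions, this is the addition formulas for cosine and sine, and Fubini then
    separates each of the four products. *)
Lemma chf_convol mu nu s l : chf (convol mu nu) s l = chf mu s l * chf nu s l.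
Proof.
have bre := bounded_mfun_re s l; have bim := bounded_mfun_im s l.
have bM (f g : RZ2 R -> R) : bounded_mfun f -> bounded_mfun g ->
    (mu \x nu)%E.-integrable setT (EFin \o (fun z => f z.1 * g z.2)).
  move=> bf bg.
  apply: (bounded_mfun_integrable
    ((mu \x nu)%E : probability (RZ2 R * RZ2 R)%type R)).
  by apply: bounded_mfunM; [apply: (bounded_mfun_comp (h := fst))|
    apply: (bounded_mfun_comp (h := snd))].
rewrite !chfE /convol !Rintegral_distribution//.
under eq_Rintegral do rewrite character_reD.
under [in X in (_ +i* X)%C]eq_Rintegral do rewrite character_imD.
rewrite RintegralB ?RintegralD//; try exact: bM.
by rewrite !Rintegral_prodM.
Qed.

Lemma chf_dirac (x : RZ2 R) s l :
  chf (\d_x : M1) s l = cexp (0 +i* (x.1 * s))%C * (-1) ^+ (x.2 * l)%N.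
Proof.
rewrite chfE characterE; congr (_ +i* _)%C; apply: Rintegral_dirac.
  by case: (bounded_mfun_re s l).
by case: (bounded_mfun_im s l).
Qed.

Lemma chf_ofR (gamma : probability R R) s l : chf (ofR gamma) s l = chfR gamma s.
Proof.
rewrite chfE /ofR !Rintegral_distribution; last 2 first.
  exact: bounded_mfun_im.
  exact: bounded_mfun_re.
by rewrite /chfR /cintegral; congr (_ +i* _)%C; apply: eq_Rintegral => t _;
  rewrite /character_re /character_im cexpi /injR/= mulr1.
Qed.

Lemma chf_ofZ2 (omega : probability bool R) s l : chf (ofZ2 omega) s l =
  (\int[omega]_k (-1) ^+ (k * l)%N)%:C%C.
Proof.
rewrite chfE /ofZ2 !Rintegral_distribution; last 2 first.
  exact: bounded_mfun_im.
  exact: bounded_mfun_re.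
congr (_ +i* _)%C.
  by apply: eq_Rintegral => k _; rewrite /character_re/= mul0r cos0 mul1r.
rewrite (@eq_Rintegral _ _ _ _ _ (fun=> 0)); first by rewrite Rintegral_cst// mul0r.
by move=> k _; rewrite /character_im/= mul0r sin0 mul0r.
Qed.

End CharacteristicFunction.

(** * Integrals of derivatives and moments of the normal density *)

Section GaussianFourier.
Context (R : realType).
Notation leb := (@lebesgue_measure R).

(** Integration by parts on the whole line, in the only form needed here: the
    boundary terms are only required to vanish along the integer translates of a
    centre [m], which is all that dominated convergence on growing intervals
    uses. *)
Lemma Rintegral_derivative_eq0 (F f : R -> R) (m : R) :
  (forall x, is_derive x (1 : R) F (f x)) -> continuous f ->
  leb.-integrable setT (EFin \o f) ->
  F (m + n%:R) @[n --> \oo] --> (0 : R) -> F (m - n%:R) @[n --> \oo] --> (0 : R) ->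
  \int[leb]_x f x = 0.
Proof.
move=> dF cf intf Fy FNy.
pose D n := `[m - n%:R, m + n%:R]%classic : set R.
pose f_ n := (EFin \o f) \_ (D n).
have mf : measurable_fun setT (EFin \o f) by case/integrableP : intf.
have cvg1 : (\int[leb]_x (f_ n x) @[n --> \oo] --> \int[leb]_x (EFin \o f) x)%E.
  apply: (@dominated_cvg _ _ _ leb _ measurableT f_ (EFin \o f) (abse \o (EFin \o f))) => //.
  - move=> n; apply/(measurable_restrict _ _ _) => //; first exact: measurable_itv.
    exact: measurable_funTS.
  - move=> x _; apply: cvg_near_cst.
    near=> n; rewrite /f_ patchE mem_set//= /D/= in_itv/= lerBlDr -lerBlDl.
    have /ler_normlP[h1 h2] : `|x - m| <= n%:R.
      by near: n; exact: nbhs_infty_ger.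
    by apply/andP; split; lra.
  - exact: integrable_abse.
  - by move=> n x _; rewrite /f_ patchE; case: ifP => // _; rewrite abse0 abse_ge0.
have FTC n : (\int[leb]_x f_ n.+1 x = (F (m + n.+1%:R) - F (m - n.+1%:R))%:E)%E.
  rewrite /f_ -integral_mkcond.
  have mn : m - n.+1%:R < m + n.+1%:R.
    by rewrite ltrD2l gtrN// ltr0n.
  rewrite (continuous_FTC2 (F := F) mn)//.
  - exact: continuous_subspaceT.
  - split.
    + by move=> x _; exact: ex_derive.
    + apply: cvg_at_right_filter.
      by apply: differentiable_continuous; apply/derivable1_diffP; exact: ex_derive.
    + apply: cvg_at_left_filter.
      by apply: differentiable_continuous; apply/derivable1_diffP; exact: ex_derive.
  - by move=> x _; rewrite derive1E derive_val.
have cvg2 : (\int[leb]_x (f_ n x) @[n --> \oo] --> (0%:E : \bar R))%E.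
  rewrite -cvg_shiftS /=.
  rewrite (_ : (fun n => _) = (fun n => (F (m + n.+1%:R) - F (m - n.+1%:R))%:E));
    last by apply/funext => n; rewrite FTC.
  apply: cvg_EFin; first exact: nearW.
  rewrite -[X in _ --> X](subrr 0); apply: cvgB.
    by move: Fy; rewrite -cvg_shiftS; apply.
  by move: FNy; rewrite -cvg_shiftS; apply.
by rewrite /Rintegral (cvg_unique _ cvg1 cvg2).
Unshelve. all: end_near. Qed.

End GaussianFourier.

Section NormalMoments.
Context (R : realType) (m h : R) (h0 : 0 < h).
Local Notation leb := (@lebesgue_measure R).
Local Notation p := (normal_pdf m h).
Let q := normal_pdf m (Num.sqrt 2 * h).
Let hn0 : h != 0. Proof. by rewrite gt_eqF. Qed.

(** Half of the Gaussian exponent is set aside to absorb a power of [t - m]; what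
    remains is, up to a constant, the density [q] of doubled variance, which is
    integrable and bounded. *)
Lemma normal_pdf_exp t :
  p t = Num.sqrt 2 * q t * expR (- ((t - m) ^+ 2 / (4 * h ^+ 2))).
Proof.
have s20 : Num.sqrt 2 != 0 :> R by rewrite gt_eqF// sqrtr_gt0.
have s22 : Num.sqrt 2 ^+ 2 = 2 :> R by rewrite sqr_sqrtr.
rewrite /q !normal_pdfE ?mulf_neq0//.
rewrite /normal_fun [in RHS]mulrA -[RHS]mulrA -expRD; congr (_ * _).
  rewrite /normal_peak exprMn s22.
  rewrite (_ : 2 * h ^+ 2 * pi *+ 2 = 2 * (h ^+ 2 * pi *+ 2)); last by ring.
  by rewrite (sqrtrM (h ^+ 2 * pi *+ 2))// invfM mulrA divff// mul1r.
have -> : (Num.sqrt 2 * h) ^+ 2 = 2 * h ^+ 2 by rewrite exprMn s22.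
by congr expR; field.
Qed.

Lemma normal_pdf_moment1 t : `|t - m| * p t <= Num.sqrt 2 * h * q t.
Proof.
set x := t - m.
have q0 : 0 <= q t by exact: normal_pdf_ge0.
have E : 0 < expR (- (x ^+ 2 / (4 * h ^+ 2))) by exact: expR_gt0.
rewrite normal_pdf_exp -/x.
have : `|x| * expR (- (x ^+ 2 / (4 * h ^+ 2))) <= h.
  rewrite expRN ler_pdivrMr ?expR_gt0//.
  have e1 : 1 + x ^+ 2 / (4 * h ^+ 2) <= expR (x ^+ 2 / (4 * h ^+ 2)).
    exact: expR_ge1Dx.
  apply: (le_trans _ (ler_wpM2l (ltW h0) e1)).
  have -> : h * (1 + x ^+ 2 / (4 * h ^+ 2)) = `|x| + (`|x| - 2 * h) ^+ 2 / (4 * h).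
    by rewrite -(real_normK (num_real x)); field; rewrite hn0.
  by rewrite lerDl divr_ge0// ?sqr_ge0// mulr_ge0// ltW.
have s2 : 0 <= Num.sqrt 2 * q t by rewrite mulr_ge0// sqrtr_ge0.
by move/(ler_wpM2l s2); lra.
Qed.

Lemma normal_pdf_moment2 t : (t - m) ^+ 2 * p t <= 4 * Num.sqrt 2 * h ^+ 2 * q t.
Proof.
set x := t - m.
have q0 : 0 <= q t by exact: normal_pdf_ge0.
rewrite normal_pdf_exp -/x.
have : x ^+ 2 * expR (- (x ^+ 2 / (4 * h ^+ 2))) <= 4 * h ^+ 2.
  rewrite expRN ler_pdivrMr ?expR_gt0//.
  have e1 : 1 + x ^+ 2 / (4 * h ^+ 2) <= expR (x ^+ 2 / (4 * h ^+ 2)).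
    exact: expR_ge1Dx.
  have h2 : 0 < 4 * h ^+ 2 by rewrite mulr_gt0// exprn_gt0.
  rewrite -ler_pdivrMl// mulrC; apply: le_trans e1.
  by rewrite lerDr.
have s2 : 0 <= Num.sqrt 2 * q t by rewrite mulr_ge0// sqrtr_ge0.
by move/(ler_wpM2l s2); lra.
Qed.

End NormalMoments.

(** * Measures given by a density *)

Section Density.
Context d (T : measurableType d) (R : realType).
Variable mu : {measure set T -> \bar R}.

(** The conditions on [g] are arguments so that the instances below can be
    attached to the function itself. *)
Definition density_prob (g : T -> R) (mg : measurable_fun setT g)
    (g0 : forall x, 0 <= g x) (g1 : (\int[mu]_x (g x)%:E)%E = 1%E) : set T -> \bar R :=
  fun A => (\int[mu]_(x in A) (g x)%:E)%E.

Section DensityIsProbability.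
Variables (g : T -> R) (mg : measurable_fun setT g) (g0 : forall x, 0 <= g x).
Variable (g1 : (\int[mu]_x (g x)%:E)%E = 1%E).
Local Notation nu := (density_prob mg g0 g1).

Let nu0 : nu set0 = 0%E. Proof. exact: integral_set0. Qed.

Let nu_ge0 A : (0 <= nu A)%E.
Proof. by apply: integral_ge0 => x _; rewrite lee_fin. Qed.

Let nu_sigma_additive : semi_sigma_additive nu.
Proof.
move=> A mA tA mUA; rewrite /density_prob ge0_integral_bigcup//.
- by apply: is_cvg_ereal_nneg_natsum_cond => n _ _; exact: nu_ge0.
- by apply/measurable_EFinP; exact: measurable_funTS.
- by move=> x _; rewrite lee_fin.
Qed.

HB.instance Definition _ := isMeasure.Build _ _ _ nu nu0 nu_ge0 nu_sigma_additive.

HB.instance Definition _ := @Measure_isProbability.Build _ _ R nu g1.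

End DensityIsProbability.

Section IntegralDensity.
Variables (nu : probability T R) (g : T -> R).
Hypotheses (mg : measurable_fun setT g) (g0 : forall x, 0 <= g x).
Hypothesis nuE : forall A, measurable A -> nu A = (\int[mu]_(x in A) (g x)%:E)%E.

Let integral_density_indic E : measurable E ->
  (\int[nu]_x (\1_E x)%:E = \int[mu]_x ((\1_E x)%:E * (g x)%:E))%E.
Proof.
move=> mE; rewrite integral_indic// setIT; rewrite [LHS]nuE// integral_mkcond.
apply: eq_integral => x _; rewrite patchE indicE.
by case: ifPn => xE; rewrite ?mul1e ?mul0e.
Qed.

Import HBNNSimple.

Let integral_density_nnsfun (f : {nnsfun T >-> R}) :
  (\int[nu]_x (f x)%:E = \int[mu]_x ((f x)%:E * (g x)%:E))%E.
Proof.
under [LHS]eq_integral do rewrite fimfunE -fsumEFin//.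
rewrite [LHS]ge0_integral_fsum//; last 2 first.
  - by move=> r; exact/measurable_EFinP/measurableT_comp.
  - by move=> n x _; rewrite EFinM nnfun_muleindic_ge0.
under [RHS]eq_integral.
  move=> x xD; rewrite fimfunE -fsumEFin// muleC ge0_mule_fsumr; last first.
    by move=> r; rewrite EFinM nnfun_muleindic_ge0.
  over.
rewrite [RHS]ge0_integral_fsum//; last 2 first.
  - move=> r; apply/measurable_EFinP/measurable_funM => //.
    by do 2 apply/measurableT_comp => //.
  - move=> n x _; apply: mule_ge0; first by rewrite lee_fin.
    by rewrite EFinM nnfun_muleindic_ge0.
apply: eq_fsbigr => r rf.
have r0 : 0 <= r by move: rf; rewrite inE => -[x _ <-].
under eq_integral do rewrite EFinM.
under [RHS]eq_integral do rewrite EFinM muleCA (muleC (g _)%:E).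
rewrite !ge0_integralZl//.
- by rewrite integral_density_indic.
- by apply/measurable_EFinP/measurable_funM => //; exact: measurable_indic.
- by move=> x _; rewrite mule_ge0// lee_fin.
- by apply/measurable_EFinP; exact: measurable_indic.
Qed.

Lemma ge0_integral_density (f : T -> \bar R) :
  measurable_fun setT f -> (forall x, 0 <= f x)%E ->
  (\int[nu]_x f x = \int[mu]_x (f x * (g x)%:E))%E.
Proof.
move=> mf f0.
pose f_ := nnsfun_approx measurableT mf.
transitivity (lim (\int[nu]_x (f_ n x)%:E @[n --> \oo])%E).
  rewrite -monotone_convergence//=.
  - apply: eq_integral => ? /[!inE] xD; apply/esym/cvg_lim => //=.
    exact: cvg_nnsfun_approx.
  - by move=> n; exact/measurable_EFinP/measurable_funTS.
  - by move=> n ? _; rewrite lee_fin.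
  - by move=> ? _ ? ? mn; rewrite lee_fin; exact/lefP/nd_nnsfun_approx.
transitivity (lim (\int[mu]_x ((f_ n x)%:E * (g x)%:E) @[n --> \oo])%E).
  by apply: congr_lim; apply/funext => n /=; exact: integral_density_nnsfun.
rewrite -monotone_convergence//=.
- apply: eq_integral => x _; apply/cvg_lim => //.
  by apply: cvgeZr => //; exact: cvg_nnsfun_approx.
- by move=> n; apply/measurable_EFinP/measurable_funM => //; exact/measurable_funTS.
- by move=> n x _; rewrite mule_ge0// lee_fin.
- move=> x _ ? ? mn; rewrite -!EFinM lee_fin ler_wpM2r//.
  exact/lefP/nd_nnsfun_approx.
Qed.

Lemma integrable_density : mu.-integrable setT (EFin \o g).
Proof.
apply/integrableP; split; first exact/measurable_EFinP.
rewrite (eq_integral (EFin \o g)); last by move=> x _; rewrite /= ger0_norm.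
by rewrite -nuE// probability_setT ltry.
Qed.

Lemma bounded_mfun_integrableM (f : T -> R) : bounded_mfun f ->
  mu.-integrable setT (EFin \o (fun x => f x * g x)).
Proof.
move=> [mf [M fM]].
apply: (@le_integrable _ _ _ mu _ measurableT _ (EFin \o (fun x => M * g x))).
- by apply/measurable_EFinP; exact: measurable_funM.
- move=> x _; rewrite lee_fin.
  have M0 : 0 <= M by exact: le_trans (fM x).
  by rewrite [leRHS]ger0_norm ?mulr_ge0// normrM (ger0_norm (g0 x)) ler_wpM2r.
- have := integrableZl measurableT M integrable_density.
  by apply: eq_integrable => // x _; rewrite /= EFinM.
Qed.

(** Adding an upper bound of the absolute value of [f] makes the integrand
    nonnegative, where the identity holds by monotone approximation. *)
Lemma Rintegral_density (f : T -> R) : bounded_mfun f ->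
  \int[nu]_x f x = \int[mu]_x (f x * g x).
Proof.
move=> bf; have [mf [M fM]] := bf.
have fM0 x : 0 <= f x + M by move: (fM x) => /ler_normlP[]; lra.
have bM := bounded_mfun_cst T M.
have intg1 : \int[mu]_x g x = 1.
  by rewrite /Rintegral -nuE// probability_setT.
have /(congr1 fine) : (\int[nu]_x (f x + M)%:E = \int[mu]_x ((f x + M) * g x)%:E)%E.
  rewrite ge0_integral_density//.
  by apply/measurable_EFinP; exact: measurable_funD.
rewrite -!/(Rintegral _ _ _) RintegralD//; try exact: bounded_mfun_integrable.
under [in RHS]eq_Rintegral do rewrite mulrDl.
rewrite RintegralD//; try exact: bounded_mfun_integrableM.
rewrite RintegralZl//; last exact: integrable_density.
rewrite Rintegral_cst//.
rewrite [X in M * fine X](_ : _ = 1%E); last exact: probability_setT.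
by rewrite intg1 /= => /addIr.
Qed.

End IntegralDensity.
End Density.

(** * The characteristic function of a normal law *)

Section NormalFourier.
Context (R : realType) (m h : R) (h0 : 0 < h).
Local Notation leb := (@lebesgue_measure R).
Local Notation p := (normal_pdf m h).
Local Notation q := (normal_pdf m (Num.sqrt 2 * h)).
Let hn0 : h != 0. Proof. by rewrite gt_eqF. Qed.

Lemma is_derive_affine (s m' c t : R) :
  is_derive t (1 : R) (fun t => s * (t - m') + c) s.
Proof.
have -> : (fun t => s * (t - m') + c) = s \*: (id - cst m') + cst c by [].
by apply: is_derive_eq; rewrite subr0 addr0 /GRing.scale/= mulr1.
Qed.

Lemma is_derive_normal_pdf t : is_derive t (1 : R) p (- ((t - m) / h ^+ 2) * p t).
Proof.
rewrite normal_pdfE//.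
have d1 : is_derive t (1 : R) (fun t => - (t - m) ^+ 2 / (h ^+ 2 *+ 2))
    (- ((t - m) / h ^+ 2)).
  have -> : (fun t => - (t - m) ^+ 2 / (h ^+ 2 *+ 2)) =
      (- (h ^+ 2 *+ 2)^-1) \*: ((id - cst m) ^+ 2).
    by apply/funext => u; rewrite /= mulrC mulrN -mulNr.
  have E (a : R) : - (h ^+ 2 *+ 2)^-1 * (2 * a ^+ 1 * 1) = - (a / h ^+ 2) by field.
  by apply: is_derive_eq; rewrite subr0; exact: E.
have d2 := @is_derive1_comp _ expR _ t _ _ (is_derive_expR _) d1.
have d3 := is_deriveZ (normal_peak h) d2.
by apply: (is_derive_eq d3); rewrite /GRing.scale/= /normal_fun; ring.
Qed.

Lemma is_derive_sin_normal_pdf s c t :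
  is_derive t (1 : R) (fun t => sin (s * (t - m) + c) * p t)
    ((s * cos (s * (t - m) + c) - (t - m) / h ^+ 2 * sin (s * (t - m) + c)) * p t).
Proof.
have d1 := @is_derive1_comp _ sin _ t _ _ (is_derive_sin _) (is_derive_affine s m c t).
have d2 := is_deriveM d1 (is_derive_normal_pdf t).
by apply: (is_derive_eq d2); rewrite /GRing.scale/=; ring.
Qed.

Lemma integrable_normal_moment1 (f : R -> R) : bounded_mfun f ->
  leb.-integrable setT (EFin \o (fun t => (t - m) * f t * p t)).
Proof.
move=> [mf [M fM]].
have M0 : 0 <= M by exact: le_trans (fM 0).
apply: (@le_integrable _ _ _ leb _ measurableT _
  (fun t => (M * (Num.sqrt 2 * h))%:E * (q t)%:E)%E).
- apply/measurable_EFinP; apply: measurable_funM; last exact: measurable_normal_pdf.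
  by apply: measurable_funM => //; exact: measurable_funB.
- move=> t _; rewrite -EFinM lee_fin.
  have q0 : 0 <= q t by exact: normal_pdf_ge0.
  have p0 : 0 <= p t by exact: normal_pdf_ge0.
  rewrite [leRHS]ger0_norm ?mulr_ge0 ?sqrtr_ge0 ?(ltW h0)//.
  rewrite !normrM (ger0_norm p0) mulrAC mulrC -(mulrA M).
  by rewrite ler_pM// ?mulr_ge0//; exact: normal_pdf_moment1.
- apply: integrableZl => //; exact: integrable_normal_pdf.
Qed.

Let normal_prob_density A : measurable A ->
  normal_prob m h A = (\int[leb]_(x in A) (p x)%:E)%E.
Proof. by []. Qed.

Lemma Rintegral_normal_prob (f : R -> R) : bounded_mfun f ->
  \int[normal_prob m h]_t f t = \int[leb]_t (f t * p t).
Proof.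
move=> bf; apply: (Rintegral_density (nu := normal_prob m h)) => //.
- exact: measurable_normal_pdf.
- exact: normal_pdf_ge0.
Qed.

Lemma integrable_normal_pdfM (f : R -> R) : bounded_mfun f ->
  leb.-integrable setT (EFin \o (fun t => f t * p t)).
Proof.
move=> bf; apply: (bounded_mfun_integrableM (nu := normal_prob m h)) => //.
- exact: measurable_normal_pdf.
- exact: normal_pdf_ge0.
Qed.

Lemma measurable_affine (s c : R) : measurable_fun setT (fun t : R => s * (t - m) + c).
Proof.
by apply: measurable_funD => //; apply: measurable_funM => //; exact: measurable_funB.
Qed.

Let bcos s c : bounded_mfun (fun t : R => cos (s * (t - m) + c)).
Proof. exact: (bounded_mfun_comp (measurable_affine s c) (bounded_mfun_cos R)). Qed.

Let bsin s c : bounded_mfun (fun t : R => sin (s * (t - m) + c)).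
Proof. exact: (bounded_mfun_comp (measurable_affine s c) (bounded_mfun_sin R)). Qed.

Let K := Num.sqrt 2 * h * normal_peak (Num.sqrt 2 * h).

Lemma normal_pdf_decay t : `|t - m| * p t <= K.
Proof.
apply: (le_trans (normal_pdf_moment1 m h0 t)).
rewrite ler_wpM2l ?mulr_ge0 ?sqrtr_ge0 ?(ltW h0)//.
by apply: normal_pdf_ub; rewrite mulf_neq0// gt_eqF// sqrtr_gt0.
Qed.

Lemma cvg_sin_normal_pdf (s c : R) (u : nat -> R) :
    (forall n, `|u n - m| = n%:R) ->
  sin (s * (u n - m) + c) * p (u n) @[n --> \oo] --> (0 : R).
Proof.
move=> un; apply: norm_cvg0.
have K0 : 0 <= K by apply: le_trans (normal_pdf_decay m); rewrite mulr_ge0// normal_pdf_ge0.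
have cvgK : K * n%:R^-1 @[n --> \oo] --> (0 : R).
  rewrite -[X in _ --> X](mulr0 K); apply: cvgMr.
  rewrite -cvg_shiftS /=; exact: cvg_harmonic.
apply: (squeeze_cvgr _ (cvg_cst (0 : R)) cvgK).
near=> n; rewrite normr_ge0/=.
have n0 : 0 < n%:R :> R by rewrite ltr0n; near: n; exact: nbhs_infty_gt.
  rewrite ler_pdivlMr// mulrC -(un n) normrM.
  apply: le_trans (normal_pdf_decay (u n)).
  rewrite ler_wpM2l// (ger0_norm (normal_pdf_ge0 _ _ _)) ler_piMl ?normal_pdf_ge0//.
  by rewrite ler_norml sin_geN1 sin_le1.
Unshelve. all: end_near. Qed.

(** The normal density satisfies [p' = - (t - m) / h ^+ 2 * p], so a factor
    [t - m] can be traded for a derivative of the trigonometric factor. *)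
Lemma Rintegral_by_parts_normal s c :
  s * h ^+ 2 * (\int[leb]_t (cos (s * (t - m) + c) * p t)) =
  \int[leb]_t ((t - m) * sin (s * (t - m) + c) * p t).
Proof.
have icos := integrable_normal_pdfM (bcos s c).
have isin := integrable_normal_moment1 (bsin s c).
pose f t := (s * cos (s * (t - m) + c) - (t - m) / h ^+ 2 * sin (s * (t - m) + c)) * p t.
have fE t : f t = s * (cos (s * (t - m) + c) * p t) +
    (- (h ^+ 2)^-1) * ((t - m) * sin (s * (t - m) + c) * p t).
  by rewrite /f; ring.
have i1 : leb.-integrable setT (EFin \o (fun t => s * (cos (s * (t - m) + c) * p t))).
  by have := integrableZl measurableT s icos; apply: eq_integrable => // x _; rewrite /= EFinM.
have i2 : leb.-integrable setT (EFin \o (fun t => (- (h ^+ 2)^-1) *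
    ((t - m) * sin (s * (t - m) + c) * p t))).
  by have := integrableZl measurableT (- (h ^+ 2)^-1) isin;
    apply: eq_integrable => // x _; rewrite /= EFinM.
have : \int[leb]_t f t = 0.
  apply: (@Rintegral_derivative_eq0 _ (fun t => sin (s * (t - m) + c) * p t) f m).
  - by move=> t; exact: is_derive_sin_normal_pdf.
  - move=> t; apply: cvgM; last exact: continuous_normal_pdf.
    have caff : {for t, continuous (fun t => s * (t - m) + c)}.
      apply: differentiable_continuous; apply/derivable1_diffP.
      by have := is_derive_affine s m c t => ?; exact: ex_derive.
    apply: cvgB.
      apply: cvgMr; apply: (continuous_comp caff); exact: continuous_cos.
    apply: cvgM; last by apply: (continuous_comp caff); exact: continuous_sin.
    by apply: cvgMl; apply: cvgB; [exact: cvg_id|exact: cvg_cst].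
  - by apply: (eq_integrable _ _ _ _ (integrableD measurableT i1 i2)) => // t _;
      rewrite /= fE.
  - apply: (@cvg_sin_normal_pdf s c (fun n => m + n%:R)) => n.
    by rewrite addrAC subrr add0r normr_nat.
  - apply: (@cvg_sin_normal_pdf s c (fun n => m - n%:R)) => n.
    by rewrite addrAC subrr add0r normrN normr_nat.
under eq_Rintegral do rewrite fE.
rewrite RintegralD// !RintegralZl//.
move=> /eqP; rewrite mulNr subr_eq0 => /eqP E.
by rewrite mulrAC E mulrAC mulVf ?mul1r// expf_neq0.
Qed.

Let phi c s := \int[leb]_t (cos (s * (t - m) + c) * p t).

(** Differentiation under the integral followed by the integration by parts above
    turns the transform into a solution of a linear differential equation. The
    arbitrary phase [c] treats cosine and sine at once, and the centring at [m]
    spares any change of variables. *)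
Lemma is_derive_normal_cos c s : is_derive s (1 : R) (phi c) (- (s * h ^+ 2) * phi c s).
Proof.
pose f (x t : R) := cos (x * (t - m) + c) * p t.
have dcos x t : is_derive x (1 : R) (f ^~ t) (- ((t - m) * sin (x * (t - m) + c) * p t)).
  have d0 : is_derive x (1 : R) (fun x => x * (t - m) + c) (t - m).
    have -> : (fun x => x * (t - m) + c) = (t - m) \*: id + cst c.
      by apply/funext => y /=; rewrite mulrC.
    by apply: is_derive_eq; rewrite addr0 /GRing.scale/= mulr1.
  have d1 := @is_derive1_comp _ cos _ x _ _ (is_derive_cos _) d0.
  have d2 := is_deriveM d1 (is_derive_cst (p t) x 1).
  by apply: (is_derive_eq d2); rewrite /GRing.scale/=; ring.
have d1E x t : partial1of2 f x t = - ((t - m) * sin (x * (t - m) + c) * p t).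
  by rewrite partial1of2E; have := dcos x t => ?; exact: derive_val.
pose G t := Num.sqrt 2 * h * q t.
have hyps : [/\ forall x, `](s - 1), (s + 1)[%classic x -> leb.-integrable setT (EFin \o f x),
    forall x t, `](s - 1), (s + 1)[%classic x -> setT t -> derivable (f ^~ t) x 1,
    forall t, 0 <= G t, leb.-integrable setT (EFin \o G) &
    forall x t, `](s - 1), (s + 1)[%classic x -> setT t -> `|partial1of2 f x t| <= G t].
  split.
  - by move=> x _; exact: integrable_normal_pdfM.
  - by move=> x t _ _; have := dcos x t => ?; exact: ex_derive.
  - by move=> t; rewrite /G !mulr_ge0 ?sqrtr_ge0 ?(ltW h0) ?normal_pdf_ge0.
  - have := integrableZl measurableT (Num.sqrt 2 * h)
      (integrable_normal_pdf m (Num.sqrt 2 * h)).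
    by apply: eq_integrable => // t _; rewrite /= EFinM.
  - move=> x t _ _; rewrite d1E normrN !normrM.
    apply: le_trans (normal_pdf_moment1 m h0 t).
    rewrite (ger0_norm (normal_pdf_ge0 _ _ _)) ler_wpM2r ?normal_pdf_ge0//.
    by rewrite ler_piMr// ler_norml sin_geN1 sin_le1.
have Is : `](s - 1), (s + 1)[%classic s by rewrite /= in_itv/=; apply/andP; split; lra.
case: hyps => H1 H2 H3 H4 H5.
apply: DeriveDef.
  exact: (@derivable_under_integral _ _ _ leb f setT measurableT s _ _ Is
    H1 H2 G H3 H4 H5).
rewrite -derive1E.
rewrite (@differentiation_under_integral _ _ _ leb f setT measurableT s _ _ Is
  H1 H2 G H3 H4 H5).
under eq_Rintegral do rewrite d1E -mulN1r.
rewrite RintegralZl//; last exact: (integrable_normal_moment1 (bsin s c)).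
by rewrite -Rintegral_by_parts_normal mulN1r mulNr.
Qed.

Lemma normal_cosE c s : phi c s = cos c * expR (- (h ^+ 2 / 2 * s ^+ 2)).
Proof.
pose g s := phi c s * expR (h ^+ 2 / 2 * s ^+ 2).
have dg x : is_derive x (1 : R) g 0.
  have d0 : is_derive x (1 : R) (fun x => h ^+ 2 / 2 * x ^+ 2) (h ^+ 2 * x).
    have -> : (fun x => h ^+ 2 / 2 * x ^+ 2) = (h ^+ 2 / 2) \*: (id ^+ 2) by [].
    by apply: is_derive_eq; rewrite /GRing.scale/=; field.
  have d1 := @is_derive1_comp _ expR _ x _ _ (is_derive_expR _) d0.
  have d2 := is_deriveM (is_derive_normal_cos c x) d1.
  by apply: (is_derive_eq d2); rewrite /GRing.scale/=; ring.
have := is_derive_0_is_cst s 0 dg.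
rewrite /g expr0n mulr0 expR0 mulr1 {2}/phi.
under eq_Rintegral do rewrite mul0r add0r.
rewrite RintegralZl//; last exact: integrable_normal_pdf.
rewrite [X in _ = _ * X](_ : _ = 1); last first.
  by rewrite -[RHS]/(fine 1%E) -(integral_normal_pdf m h).
by rewrite mulr1 => <-; rewrite -[RHS]mulrA -expRD subrr expR0 mulr1.
Qed.

Lemma Rintegral_normal_cos c s :
  \int[normal_prob m h]_t cos (s * (t - m) + c) = cos c * expR (- (h ^+ 2 / 2 * s ^+ 2)).
Proof. by rewrite Rintegral_normal_prob// -normal_cosE. Qed.

End NormalFourier.

(** [normal_prob] lives on a copy of [R] whose sigma-algebra, although equal to
    that of [R], carries another display; it is transported by the identity. *)
Definition of_measurableTypeR (R : realType) (t : measurableTypeR R) : R := t.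

Lemma measurable_of_measurableTypeR (R : realType) :
  measurable_fun setT (@of_measurableTypeR R).
Proof. by move=> _ A mA; rewrite setTI. Qed.

HB.instance Definition _ (R : realType) := isMeasurableFun.Build _ _ _ _
  (@of_measurableTypeR R) (@measurable_of_measurableTypeR R).

Definition normal_law (R : realType) (m h : R) : probability R R :=
  distribution (normal_prob m h) (@of_measurableTypeR R).

Lemma Rintegral_normal_law (R : realType) (m h : R) (f : R -> R) : bounded_mfun f ->
  \int[normal_law m h]_t f t = \int[normal_prob m h]_t f t.
Proof. exact: Rintegral_distribution. Qed.

Lemma Rintegral_normal_law_pdf (R : realType) (m h : R) (f : R -> R) : bounded_mfun f ->
  \int[normal_law m h]_t f t = \int[lebesgue_measure]_t (f t * normal_pdf m h t).
Proof.
move=> bf; exact: etrans (Rintegral_normal_law _ _ bf) (Rintegral_normal_prob _ _ bf).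
Qed.

(* Unfolding [normal_law] when two integrals are compared is very costly. *)
Opaque normal_law.

Lemma gauss_chfE (R : realType) (sigma beta s : R) : gauss_chf sigma beta s =
  ((expR (- (sigma * s ^+ 2)) * cos (beta * s)) +i*
   (expR (- (sigma * s ^+ 2)) * sin (beta * s)))%C.
Proof.
by apply/eqP; rewrite eq_complex/=; apply/andP; split; apply/eqP; ring.
Qed.

Lemma chfR_normal_law (R : realType) (m h s : R) : 0 < h ->
  chfR (normal_law m h) s = gauss_chf (h ^+ 2 / 2) m s.
Proof.
move=> h0; rewrite /chfR /cintegral.
have bf c : bounded_mfun (fun t : R => cos (s * (t - m) + c)).
  exact: (bounded_mfun_comp (measurable_affine m s c) (bounded_mfun_cos R)).
rewrite gauss_chfE.
congr (_ +i* _)%C.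
  rewrite mulrC -(Rintegral_normal_cos m h0) -Rintegral_normal_law//.
  apply: eq_Rintegral => t _.
  by rewrite cexpi/=; congr cos; ring.
(* The sine is the cosine with phase [m * s - pi / 2]. *)
rewrite mulrC -cosBpihalf -(Rintegral_normal_cos m h0) -Rintegral_normal_law//.
apply: eq_Rintegral => t _.
by rewrite cexpi/= -cosBpihalf; congr cos; ring.
Qed.

(** * Gaussian smoothing is determined by the characteristic function *)

Lemma Rintegral_swap d1 d2 (T1 : measurableType d1) (T2 : measurableType d2)
    (R : realType) (P : probability T1 R) (Q : probability T2 R) (f : T1 * T2 -> R) :
  bounded_mfun f ->
  \int[P]_x (\int[Q]_y f (x, y)) = \int[Q]_y (\int[P]_x f (x, y)).
Proof.
move=> bf; rewrite -Rintegral_prod// /Rintegral -integral21_prod_meas1; last first.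
  exact: (bounded_mfun_integrable ((P \x Q)%E : probability (T1 * T2)%type R) bf).
congr fine; apply: eq_integral => y _; rewrite fineK//.
apply: integrable_fin_num => //.
apply: (bounded_mfun_integrable P (f := fun x => f (x, y))).
by apply: (bounded_mfun_comp (h := fun x => (x, y))) => //; exact: measurable_pair2.
Qed.

Section NormalTail.
Context (R : realType).
Local Notation leb := (@lebesgue_measure R).

(** Chebyshev inequality from the bound on the second moment. The constant is crude:
    only the smallness of [h / e] matters below. *)
Lemma normal_prob_tail (m h e : R) (A : set (measurableTypeR R)) : 0 < h -> 0 < e ->
  measurable A -> (forall u, A u -> e <= `|u - m|) ->
  (normal_prob m h A <= (8 * (h / e) ^+ 2)%:E)%E.
Proof.
move=> h0 e0 mA Ae; rewrite /normal_prob.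
set q := normal_pdf m (Num.sqrt 2 * h).
have mq : measurable_fun setT q by exact: measurable_normal_pdf.
have C0 : 0 <= 8 * (h / e) ^+ 2 by rewrite mulr_ge0// sqr_ge0.
apply: (@le_trans _ _ (\int[leb]_(x in A) ((8 * (h / e) ^+ 2)%:E * (q x)%:E)))%E.
  apply: ge0_le_integral => //.
  - by move=> u _; rewrite lee_fin normal_pdf_ge0.
  - by apply/measurable_EFinP; apply: measurable_funTS; exact: measurable_normal_pdf.
  - by apply/measurable_EFinP; apply: measurable_funTS; exact: measurable_funM.
  - move=> u Au; rewrite -EFinM lee_fin.
    have p0 := normal_pdf_ge0 m h u; have q0 : 0 <= q u := normal_pdf_ge0 _ _ u.
    have e2 : 0 < e ^+ 2 by rewrite exprn_gt0.
    have eu : e ^+ 2 <= (u - m) ^+ 2.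
      by rewrite -(real_normK (num_real (u - m))) lerXn2r ?nnegrE ?(ltW e0)// Ae.
    have s2 : Num.sqrt 2 <= 2 :> R.
      by rewrite -[leRHS]ger0_norm// -sqrtr_sqr ler_wsqrtr// expr2 ler_peMl// ler1n.
    rewrite -(ler_pM2l e2).
    apply: (le_trans (ler_wpM2r p0 eu)).
    apply: (le_trans (normal_pdf_moment2 m h0 u)).
    have -> : e ^+ 2 * (8 * (h / e) ^+ 2 * q u) = 4 * 2 * h ^+ 2 * q u.
      by field; rewrite gt_eqF.
    by rewrite !ler_wpM2r// ?sqr_ge0// ler_wpM2l.
rewrite ge0_integralZl//; last 2 first.
  - by apply/measurable_EFinP; exact: measurable_funTS.
  - by move=> u _; rewrite lee_fin normal_pdf_ge0.
rewrite -[leRHS]mule1 lee_wpmul2l// ?lee_fin//.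
exact: (@probability_le1 _ _ _ (normal_prob m (Num.sqrt 2 * h)) A mA).
Qed.

End NormalTail.

Section Uniqueness.
Context (R : realType).
Local Notation M1 := (probability (RZ2 R) R).
Local Notation leb := (@lebesgue_measure R).
Implicit Types (mu nu : M1) (j : bool).

Definition fibre j (x : RZ2 R) : R := (x.2 == j)%:R.

Lemma bounded_mfun_fibre j : bounded_mfun (fibre j).
Proof.
apply: (bounded_mfun_comp (h := snd) (f := fun k : bool => (k == j)%:R : R)) => //.
by split => //; exists 1 => k; case: (k == j); rewrite ?normr1 ?normr0 ?ler01.
Qed.

Lemma fibreE j x : fibre j x = 2^-1 * (1 + (-1) ^+ (x.2 * true)%N * (-1) ^+ j).
Proof. by rewrite /fibre; move: x => [t [|]]; case: j => /=; field. Qed.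

(** Fourier inversion on Z(2): the indicator of a fibre is the mean of the two
    characters of Z(2), up to sign, so a cosine localised on a fibre is a
    combination of characters of the product group. *)
Lemma cos_fibre_character s u j x : cos (s * (x.1 - u)) * fibre j x =
  2^-1 * (cos (u * s) * (character_re s false x + (-1) ^+ j * character_re s true x) +
          sin (u * s) * (character_im s false x + (-1) ^+ j * character_im s true x)).
Proof.
rewrite fibreE /character_re /character_im muln0 expr0 !mulr1.
by rewrite mulrBr cosB ![s * _]mulrC; ring.
Qed.

Lemma Rintegral_cos_fibre mu nu s u j : (forall s l, chf mu s l = chf nu s l) ->
  \int[mu]_x (cos (s * (x.1 - u)) * fibre j x) =
  \int[nu]_x (cos (s * (x.1 - u)) * fibre j x).
Proof.
move=> E.
have Ere l : \int[mu]_x character_re s l x = \int[nu]_x character_re s l x.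
  by have := E s l; rewrite !chfE => -[].
have Eim l : \int[mu]_x character_im s l x = \int[nu]_x character_im s l x.
  by have := E s l; rewrite !chfE => -[].
have split (la : M1) : \int[la]_x (cos (s * (x.1 - u)) * fibre j x) =
  2^-1 * (cos (u * s) * (\int[la]_x character_re s false x +
            (-1) ^+ j * \int[la]_x character_re s true x) +
          sin (u * s) * (\int[la]_x character_im s false x +
            (-1) ^+ j * \int[la]_x character_im s true x)).
  under eq_Rintegral do rewrite cos_fibre_character.
  have br l := bounded_mfun_re s l; have bi l := bounded_mfun_im s l.
  have bS (f g : RZ2 R -> R) : bounded_mfun f -> bounded_mfun g ->
    bounded_mfun (fun x => f x + (-1) ^+ j * g x).
    by move=> bf bg; apply: bounded_mfunD => //; exact: bounded_mfunZ.
  have bint f : bounded_mfun f -> la.-integrable setT (EFin \o f).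
    exact: bounded_mfun_integrable.
  rewrite RintegralZl//; last first.
    by apply: bint; apply: bounded_mfunD; apply: bounded_mfunZ; exact: bS.
  rewrite RintegralD//; last 2 first.
  - by apply: bint; apply: bounded_mfunZ; exact: bS.
  - by apply: bint; apply: bounded_mfunZ; exact: bS.
  rewrite !RintegralZl//; last 2 first.
  - by apply: bint; exact: bS.
  - by apply: bint; exact: bS.
  rewrite !RintegralD//; do ?[exact: bint|by apply: bint; exact: bounded_mfunZ].
  by rewrite !RintegralZl//; exact: bint.
by rewrite !split !Ere !Eim.
Qed.

(** A Gaussian bump is itself a Gaussian average of cosines, so after exchanging
    the integrals only cosines have to be integrated against the unknown
    measure. *)
Lemma Rintegral_gauss_fibre mu nu h u j : 0 < h ->
  (forall s l, chf mu s l = chf nu s l) ->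
  \int[mu]_x (normal_pdf u h x.1 * fibre j x) =
  \int[nu]_x (normal_pdf u h x.1 * fibre j x).
Proof.
move=> h0 E; have hn0 : h != 0 by rewrite gt_eqF.
pose f (xz : RZ2 R * R) : R := cos (xz.2 / h * (xz.1.1 - u)) * fibre j xz.1.
have bf : bounded_mfun f.
  apply: bounded_mfunM.
    apply: (bounded_mfun_comp (f := @cos R)); last exact: bounded_mfun_cos.
    apply: measurable_funM; first exact: measurable_funM.
    by apply: measurable_funB => //; apply: measurableT_comp.
  by apply: (bounded_mfun_comp (h := fst)) => //; exact: bounded_mfun_fibre.
have bg : bounded_mfun (fun x : RZ2 R => normal_pdf u h x.1 * fibre j x).
  apply: bounded_mfunM; last exact: bounded_mfun_fibre.
  apply: (bounded_mfun_comp (h := fst)) => //; split.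
    exact: measurable_normal_pdf.
  exists (normal_peak h) => t; rewrite ger0_norm ?normal_pdf_ge0//.
  exact: normal_pdf_ub.
have fE x : \int[normal_law 0 1]_z f (x, z) =
    (normal_peak h)^-1 * (normal_pdf u h x.1 * fibre j x).
  rewrite normal_pdfE// mulrA mulKf ?gt_eqF ?normal_peak_gt0//; apply/esym.
  rewrite /f /= RintegralZr//; last first.
    apply: bounded_mfun_integrable.
    apply: (bounded_mfun_comp (f := @cos R)); last exact: bounded_mfun_cos.
    by apply: measurable_funM => //; exact: measurable_funM.
  congr (_ * _).
  transitivity (\int[normal_law 0 1]_z cos ((x.1 - u) / h * (z - 0) + 0)).
    rewrite Rintegral_normal_law; last first.
      apply: (bounded_mfun_comp (f := @cos R)); last exact: bounded_mfun_cos.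
      exact: measurable_affine.
    by rewrite Rintegral_normal_cos// cos0 mul1r; congr expR; field.
  apply: eq_Rintegral => z _; rewrite subr0 addr0; congr cos.
  by rewrite mulrAC -mulrA mulrC.
have swap (la : M1) : \int[la]_x (normal_pdf u h x.1 * fibre j x) =
    normal_peak h * \int[normal_law 0 1]_z (\int[la]_x f (x, z)).
  rewrite -Rintegral_swap//.
  under [in RHS]eq_Rintegral do rewrite fE.
  rewrite RintegralZl//; last exact: bounded_mfun_integrable.
  by rewrite mulVKf// gt_eqF// normal_peak_gt0.
rewrite !swap; congr (_ * _); apply: eq_Rintegral => z _.
exact: (Rintegral_cos_fibre (z / h) u j E).
Qed.

End Uniqueness.

(** * Uniqueness of characteristic functions *)

Section Smoothing.
Context (R : realType).
Local Notation M1 := (probability (RZ2 R) R).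
Local Notation leb := (@lebesgue_measure R).
Implicit Types (mu nu : M1) (j : bool).

Lemma normal_pdfC (t u h : R) : h != 0 -> normal_pdf t h u = normal_pdf u h t.
Proof. by move=> h0; rewrite !normal_pdfE// /normal_fun -opprB sqrrN. Qed.

(** The probability that [x] perturbed by a centred normal variable of standard
    deviation [h] in its real coordinate falls in [A] times the fibre over [j]. *)
Definition smoothed h (A : set (measurableTypeR R)) j (x : RZ2 R) : \bar R :=
  (normal_prob x.1 h A * (fibre j x)%:E)%E.

Section FixedScale.
Variables (h : R) (A : set (measurableTypeR R)) (j : bool).
Hypotheses (h0 : 0 < h) (mA : measurable A).

Let hn0 : h != 0. Proof. by rewrite gt_eqF. Qed.

Let kernel (xu : RZ2 R * measurableTypeR R) : \bar R :=
  (normal_pdf xu.2 h xu.1.1 * fibre j xu.1 * \1_A xu.2)%:E.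

Let kernel_ge0 xu : (0 <= kernel xu)%E.
Proof. by rewrite lee_fin !mulr_ge0// ?normal_pdf_ge0// /fibre ler0n. Qed.

Let measurable_kernel : measurable_fun setT kernel.
Proof.
apply/measurable_EFinP; apply: measurable_funM; last first.
  by apply: (measurableT_comp (measurable_indic mA)).
apply: measurable_funM; last first.
  by apply: (measurableT_comp (bounded_mfun_fibre _ j).1).
rewrite (_ : (fun _ => _) = (fun xu : RZ2 R * measurableTypeR R =>
    normal_pdf 0 h (xu.1.1 - xu.2))); last first.
  by apply/funext => xu; rewrite !normal_pdfE// /normal_fun subr0.
apply: (measurableT_comp (measurable_normal_pdf 0 h)).
apply: measurable_funB; last exact: measurable_snd.
by apply: measurableT_comp.
Qed.

Let integral_kernel x : (\int[leb]_u kernel (x, u) = smoothed h A j x)%E.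
Proof.
rewrite /smoothed /normal_prob [in RHS]integral_mkcond -ge0_integralZr//; last 3 first.
- by apply/(measurable_restrict _ _ _) => //; apply/measurable_EFinP;
    apply: measurable_funTS; exact: measurable_normal_pdf.
- by move=> u _; rewrite patchE; case: ifP => // _; rewrite lee_fin normal_pdf_ge0.
- by rewrite lee_fin /fibre ler0n.
apply: eq_integral => u _; rewrite /kernel/= patchE indicE normal_pdfC//.
by case: ifP => uA; rewrite ?mulr1 ?mulr0 ?mul0e// EFinM.
Qed.

Lemma measurable_smoothed : measurable_fun setT (smoothed h A j).
Proof.
rewrite (_ : smoothed h A j = (fun x => \int[leb]_u kernel (x, u))%E).
  exact: measurable_fun_fubini_tonelli_F.
by apply/funext => x; rewrite integral_kernel.
Qed.

(** By Tonelli the smoothed measure of [A] is the integral over [A] of its density,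
    whose values are the integrals of Gaussian bumps. *)
Lemma integral_smoothed mu : (\int[mu]_x smoothed h A j x =
  \int[leb]_(u in A) (\int[mu]_x (normal_pdf u h x.1 * fibre j x))%:E)%E.
Proof.
under eq_integral do rewrite -integral_kernel.
rewrite fubini_tonelli// [RHS]integral_mkcond; apply: eq_integral => u _.
rewrite patchE /kernel/= indicE; case: ifP => uA.
  under eq_integral do rewrite mulr1.
  rewrite /Rintegral fineK//; apply: integrable_fin_num => //.
  apply: (bounded_mfun_integrable mu (f := fun x => normal_pdf u h x.1 * fibre j x)).
  apply: bounded_mfunM; last exact: bounded_mfun_fibre.
  apply: (bounded_mfun_comp (h := fst)) => //; split.
    exact: measurable_normal_pdf.
  exists (normal_peak h) => t; rewrite ger0_norm ?normal_pdf_ge0//.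
  exact: normal_pdf_ub.
by under eq_integral do rewrite mulr0; rewrite integral0.
Qed.

End FixedScale.

Lemma integral_smoothed_chf mu nu h (A : set (measurableTypeR R)) j :
  0 < h -> measurable A -> (forall s l, chf mu s l = chf nu s l) ->
  (\int[mu]_x smoothed h A j x = \int[nu]_x smoothed h A j x)%E.
Proof.
move=> h0 mA E; rewrite !integral_smoothed//; apply: eq_integral => u _.
by rewrite (Rintegral_gauss_fibre u j h0 E).
Qed.

Definition ray (c : R) : set (measurableTypeR R) := `[c, +oo[%classic.

Lemma measurable_ray c : measurable (ray c).
Proof. exact: measurable_itv. Qed.

(* The standard deviation tends to 0 faster than the margin added to the ray, so
   that the perturbed point lands in the enlarged ray with probability tending to
   the indicator of the ray itself, endpoint included: a single limit suffices. *)
Let scale n : R := n.+1%:R ^- 2.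
Let margin n : R := n.+1%:R^-1.

Let scale_gt0 n : 0 < scale n.
Proof. by rewrite invr_gt0 exprn_gt0// ltr0n. Qed.

Let margin_gt0 n : 0 < margin n.
Proof. by rewrite invr_gt0 ltr0n. Qed.

Let cvg_margin : margin n @[n --> \oo] --> (0 : R).
Proof. exact: cvg_harmonic. Qed.

Lemma cvg_normal_ray (c t : R) :
  normal_prob t (scale n) (ray (c - margin n)) @[n --> \oo] -->
  ((c <= t)%R%:R%:E : \bar R).
Proof.
have small : (8 * margin n ^+ 2)%:E @[n --> \oo] --> (0%:E : \bar R).
  apply: cvg_EFin; first exact: nearW.
  rewrite -[X in _ --> X](mulr0 8); apply: cvgMr.
  by rewrite -[X in _ --> X](mulr0 0); apply: cvgM.
have sm n : scale n / margin n = margin n.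
  by rewrite /scale /margin invrK expr2 invfM -mulrA mulVf ?mulr1 ?pnatr_eq0.
have [ct|tc] := leP c t; last first.
  have tcn : \forall n \near \oo, margin n <= (c - t) / 2.
    have : 0 < (c - t) / 2 by rewrite divr_gt0// subr_gt0.
    by move=> /(cvgr_le _ cvg_margin); apply.
  have bnd : \forall n \near \oo, (0 <= normal_prob t (scale n) (ray (c - margin n))
      <= (8 * margin n ^+ 2)%:E)%E.
    near=> n; rewrite measure_ge0/=.
    have mn : margin n <= (c - t) / 2 by near: n.
    have := @normal_prob_tail _ t (scale n) (margin n) (ray (c - margin n))
      (scale_gt0 n) (margin_gt0 n) (measurable_ray _).
    rewrite sm; apply => u; rewrite /ray/= in_itv/= andbT => cu.
    rewrite ler_normr; apply/orP; left; lra.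
  exact: (squeeze_cvge bnd (cvg_cst _) small).
pose B n := ~` ray (c - margin n).
have mB n : measurable (B n) by apply: measurableC; exact: measurable_ray.
have bnd n : (0 <= normal_prob t (scale n) (B n) <= (8 * margin n ^+ 2)%:E)%E.
  rewrite measure_ge0/=.
  have := @normal_prob_tail _ t (scale n) (margin n) (B n)
      (scale_gt0 n) (margin_gt0 n) (mB n).
  rewrite sm; apply => u; rewrite /B /ray/= in_itv/= andbT => /negP.
  rewrite -ltNge => cu; rewrite ler_normr; apply/orP; right; lra.
have cB : normal_prob t (scale n) (B n) @[n --> \oo] --> (0%:E : \bar R).
  by apply: (squeeze_cvge _ (cvg_cst _) small); exact: nearW.
rewrite (_ : (fun n => _) = (fun n => 1%:E - normal_prob t (scale n) (B n))%E).
  rewrite -[X in _ --> X]sube0; apply: cvgeB => //; exact: cvg_cst.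
apply/funext => n; rewrite -probability_setC//.
by rewrite /B setCK.
Unshelve. all: end_near. Qed.

Lemma integral_ray_fibre mu c j :
  (\int[mu]_x smoothed (scale n) (ray (c - margin n)) j x @[n --> \oo] -->
   mu (ray c `*` [set j]))%E.
Proof.
have mS : measurable (ray c `*` [set j] : set (RZ2 R)).
  by apply: measurableX => //; exact: measurable_ray.
rewrite -[X in mu X]setIT -integral_indic//.
apply: (@dominated_cvg _ _ _ mu _ measurableT
  (fun n => smoothed (scale n) (ray (c - margin n)) j)
  (EFin \o \1_(ray c `*` [set j])) (cst 1%E)).
- by move=> n; apply: measurable_smoothed => //; exact: measurable_ray.
- move=> x _; rewrite /smoothed.
  have -> : (EFin \o \1_(ray c `*` [set j])) x = ((c <= x.1)%R%:R%:E * (fibre j x)%:E)%E.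
    rewrite /fibre -EFinM -natrM /= indicE; congr (_%:R%:E).
    rewrite (_ : (x \in _) = (c <= x.1)%R && (x.2 == j)).
      by case: (_ <= _); case: (_ == _).
    apply/idP/idP; rewrite inE /ray/= in_itv/= andbT.
      by move=> [-> ->]; rewrite eqxx.
    by move=> /andP[-> /eqP ->].
  by apply: cvgeZr => //; exact: cvg_normal_ray.
- by [].
- exact: (bounded_mfun_integrable mu (bounded_mfun_cst (RZ2 R) 1)).
- move=> n x _; rewrite /smoothed abseM.
  rewrite gee0_abs ?measure_ge0// gee0_abs ?lee_fin ?ler0n//.
  rewrite -[leRHS]mule1; apply: lee_pmul => //; rewrite ?lee_fin ?ler0n//.
  + by rewrite probability_le1//; exact: measurable_ray.
  + by rewrite /fibre lern1 leq_b1.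
Qed.

Lemma measure_ray_fibre mu nu c j : (forall s l, chf mu s l = chf nu s l) ->
  mu (ray c `*` [set j]) = nu (ray c `*` [set j]).
Proof.
move=> E; apply: (cvg_unique _ (integral_ray_fibre (c := c) (j := j))) => //.
have := integral_ray_fibre (mu := nu) (c := c) (j := j).
rewrite (_ : (fun n => _) = (fun n =>
  \int[mu]_x smoothed (scale n) (ray (c - margin n)) j x)%E)//.
apply/funext => n; apply: integral_smoothed_chf => //; exact: measurable_ray.
Qed.

End Smoothing.

Section Injectivity.
Context (R : realType).
Local Notation M1 := (probability (RZ2 R) R).
Implicit Types (mu nu : M1) (j : bool).

Section Slice.
Variables (mu : M1) (j : bool).

Let slice : set R -> \bar R := fun A => mu (A `*` [set j]).

Let slice0 : slice set0 = 0%E.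
Proof. by rewrite /slice set0X measure0. Qed.

Let slice_ge0 A : (0 <= slice A)%E.
Proof. exact: measure_ge0. Qed.

Let slice_sigma_additive : semi_sigma_additive slice.
Proof.
move=> F mF tF mUF; rewrite /slice setX_bigcupl.
apply: measure_semi_sigma_additive.
- by move=> n; exact: measurableX.
- apply/trivIsetP => a b _ _ ab; apply/seteqP; split => // -[t k] [[/= Fa _] [/= Fb _]].
  have : (F a `&` F b) t by [].
  by move/trivIsetP : tF => /(_ _ _ I I ab) ->.
- by rewrite -setX_bigcupl; exact: measurableX.
Qed.

HB.instance Definition _ := isMeasure.Build _ _ _ slice
  slice0 slice_ge0 slice_sigma_additive.

Definition slice_measure : {measure set R -> \bar R} := slice.

End Slice.

Let sliceE mu j A : slice_measure mu j A = mu (A `*` [set j]).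
Proof. by []. Qed.

(** A law on the product is the pair of its restrictions to the two fibres, and a
    finite measure on the line is determined by its values on rays. *)
Theorem chf_inj mu nu : (forall s l, chf mu s l = chf nu s l) -> mu ≡μ nu.
Proof.
move=> E.
have slice_eq j A : measurable A -> slice_measure mu j A = slice_measure nu j A.
  apply: (@measure_unique _ R R (@RGenCInfty.G R) (fun k => `[- k%:R, +oo[%classic)
    _ _ _ _ (slice_measure mu j) (slice_measure nu j)).
  - exact: RGenCInfty.measurableE.
  - move=> _ _ [x ->] [y ->]; exists (Num.max x y).
    by apply/seteqP; split => z /=; rewrite !in_itv/= !andbT ge_max => /andP.
  - by move=> k; exists (- k%:R).
  - apply/seteqP; split => // x _; exists (Num.truncn `|x|).+1 => //=.
    rewrite in_itv/= andbT.
    have := Num.Theory.truncnS_gt `|x|; have := ler_norm (- x); rewrite normrN; lra.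
  - move=> _ [x ->]; exact: measure_ray_fibre.
  - move=> k; rewrite sliceE; apply: le_lt_trans (ltry 1).
    apply: probability_le1; apply: measurableX => //; exact: measurable_itv.
move=> S mS.
have mY j : measurable (ysection S j) by exact: measurable_ysection.
have SE : S = (ysection S true `*` [set true]) `|` (ysection S false `*` [set false]).
  apply/seteqP; split => [[t [|]] St|[t k] [] /= [+ ->]].
  - by left; split => //; rewrite /ysection/= inE.
  - by right; split => //; rewrite /ysection/= inE.
  - by rewrite /ysection/= inE.
  - by rewrite /ysection/= inE.
have dis : (ysection S true `*` [set true]) `&` (ysection S false `*` [set false]) = set0.
  by apply/seteqP; split => // -[t k] [[_ /= ->] [_ /=]].
rewrite SE !measureU//; do ?exact: measurableX.
by congr (_ + _)%E; exact: slice_eq.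
Qed.

End Injectivity.

(** * Existence of the laws of Theta *)

(** Convexity of a quadratic (the Cauchy-Schwarz inequality in Engel form). It is
    used both for the positivity of the density of a law of Theta and for the
    comparison of the bounds on [kappa] under convolution. *)
Lemma sqrD_div_le (R : realFieldType) (a b A B : R) : 0 < A -> 0 < B ->
  (a + b) ^+ 2 / (A + B) <= a ^+ 2 / A + b ^+ 2 / B.
Proof.
move=> A0 B0; have AB0 : 0 < A + B by exact: addr_gt0.
rewrite -subr_ge0.
have -> : a ^+ 2 / A + b ^+ 2 / B - (a + b) ^+ 2 / (A + B) =
    (a * B - b * A) ^+ 2 / (A * B * (A + B)).
  by field; rewrite !gt_eqF.
by rewrite divr_ge0 ?sqr_ge0// !mulr_ge0// ltW.
Qed.

Section TwoPointLaws.
Context (R : realType).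

Lemma bounded_mfun_bool (f : bool -> R) : bounded_mfun f.
Proof.
split => //; exists (`|f true| + `|f false|) => -[|]; first by rewrite lerDl.
by rewrite lerDr.
Qed.

Lemma Rintegral_bernoulli (p : R) (f : bool -> R) : 0 <= p <= 1 ->
  \int[bernoulli_prob p]_k f k = p * f true + (1 - p) * f false.
Proof.
move=> p01; pose M := `|f true| + `|f false|.
have fM k : 0 <= f k + M.
  have := ler_norm (- f k); rewrite normrN /M.
  have := normr_ge0 (f true); have := normr_ge0 (f false); case: k; lra.
have /(congr1 fine) : (\int[bernoulli_prob p]_k (f k + M)%:E =
    p%:E * (f true + M)%:E + (1 - p)%:E * (f false + M)%:E)%E.
  by rewrite integral_bernoulli_prob.
rewrite -!EFinM -EFinD -/(Rintegral _ _ _) RintegralD//; last 2 first.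
- exact: bounded_mfun_integrable (bounded_mfun_bool _).
- exact: bounded_mfun_integrable (bounded_mfun_cst _ _).
rewrite Rintegral_cst//.
rewrite [X in M * fine X](_ : _ = 1%E); last exact: probability_setT.
by rewrite mulr1 /=; lra.
Qed.

Lemma chf_ofZ2_false (omega : probability bool R) s :
  chf (ofZ2 omega) s false = 1.
Proof.
rewrite chf_ofZ2; under eq_Rintegral do rewrite muln0 expr0.
rewrite Rintegral_cst// mul1r.
by rewrite [X in fine X](_ : _ = 1%E); last exact: probability_setT.
Qed.

(** The only nontrivial Fourier coefficient of a law on Z(2). *)
Definition sign_mean (omega : probability bool R) : R :=
  \int[omega]_k (-1) ^+ (k : bool).

Lemma chf_ofZ2_true (omega : probability bool R) s :
  chf (ofZ2 omega) s true = (sign_mean omega)%:C%C.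
Proof. by rewrite chf_ofZ2; under eq_Rintegral do rewrite muln1. Qed.

Lemma sign_mean_le1 (omega : probability bool R) : `|sign_mean omega| <= 1.
Proof.
apply: (le_trans (le_normr_Rintegral measurableT _)).
  exact: bounded_mfun_integrable (bounded_mfun_bool _).
under eq_Rintegral do rewrite normrX normrN1 expr1n.
rewrite Rintegral_cst// mul1r.
by rewrite [X in fine X](_ : _ = 1%E); last exact: probability_setT.
Qed.

Lemma sign_mean_bernoulli (k : R) : `|k| <= 1 ->
  sign_mean (bernoulli_prob ((1 - k) / 2)) = k.
Proof.
move=> /ler_normlP[k1 k2]; rewrite /sign_mean Rintegral_bernoulli.
  by rewrite expr1 expr0; field.
by apply/andP; split; lra.
Qed.

Lemma sign_mean_haar : sign_mean (@haarZ2 R) = 0.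
Proof.
rewrite /haarZ2 /sign_mean Rintegral_bernoulli; first by rewrite expr1 expr0; field.
by apply/andP; split; lra.
Qed.

End TwoPointLaws.

Section Existence.
Context (R : realType).
Local Notation M1 := (probability (RZ2 R) R).
Implicit Types (sigma beta kappa : R).

Lemma gauss_chf0 beta s : gauss_chf 0 beta s = cexp (0 +i* (beta * s))%C.
Proof. by rewrite /gauss_chf mul0r oppr0. Qed.

Lemma gaussian_exists sigma beta : 0 <= sigma ->
  exists gamma : probability R R, forall s, chfR gamma s = gauss_chf sigma beta s.
Proof.
rewrite le_eqVlt => /predU1P[<-|s0].
  exists (\d_beta : probability R R) => s; rewrite gauss_chf0 /chfR /cintegral cexpi.
  have mM : measurable_fun setT (fun t : R => t * s) by exact: measurable_funM.
  have E t : cexp (0 +i* (t * s))%C = (cos (t * s) +i* sin (t * s))%C by exact: cexpi.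
  congr (_ +i* _)%C.
    under eq_Rintegral do rewrite E/=.
    rewrite Rintegral_dirac//; apply: measurableT_comp mM; exact: measurable_cos.
  under eq_Rintegral do rewrite E/=.
  rewrite Rintegral_dirac//; apply: measurableT_comp mM; exact: measurable_sin.
have h0 : 0 < Num.sqrt (2 * sigma) by rewrite sqrtr_gt0 mulr_gt0.
exists (normal_law beta (Num.sqrt (2 * sigma))) => s.
rewrite chfR_normal_law// sqr_sqrtr ?mulr_ge0// ?(ltW s0)//.
by rewrite mulrAC divff// mul1r.
Qed.

Lemma chf_gauss_convol sigma beta (gamma : probability R R) (omega : probability bool R) s l :
  (forall s, chfR gamma s = gauss_chf sigma beta s) ->
  chf (convol (ofR gamma) (ofZ2 omega)) s l =
  theta_chf sigma sigma beta beta (sign_mean omega) s l.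
Proof.
move=> E; rewrite chf_convol chf_ofR E /theta_chf.
by case: l; rewrite ?chf_ofZ2_true ?chf_ofZ2_false ?mulr1 1?mulrC.
Qed.

Lemma theta_exists_eq sigma beta kappa : 0 <= sigma -> `|kappa| <= 1 ->
  exists mu : M1, forall s l, chf mu s l = theta_chf sigma sigma beta beta kappa s l.
Proof.
move=> s0 k1; have [gamma E] := gaussian_exists beta s0.
exists (convol (ofR gamma) (ofZ2 (bernoulli_prob ((1 - kappa) / 2)))) => s l.
by rewrite (chf_gauss_convol _ _ _ E) sign_mean_bernoulli.
Qed.

Definition theta_bound (sigma sigma' beta beta' : R) : R :=
  Num.sqrt (sigma' / sigma) * expR (- ((beta - beta') ^+ 2 / (4 * (sigma - sigma')))).

Section LessSpread.
Variables (sigma sigma' beta beta' kappa : R).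
Hypotheses (s'0 : 0 < sigma') (s's : sigma' < sigma).
Hypothesis kB : `|kappa| <= theta_bound sigma sigma' beta beta'.

Let s0 : 0 < sigma. Proof. exact: lt_trans s's. Qed.
Let h := Num.sqrt (2 * sigma).
Let h' := Num.sqrt (2 * sigma').
Let h0 : 0 < h. Proof. by rewrite sqrtr_gt0 mulr_gt0. Qed.
Let h'0 : 0 < h'. Proof. by rewrite sqrtr_gt0 mulr_gt0. Qed.
Let B := theta_bound sigma sigma' beta beta'.

Let pdfE b (v : R) t : 0 < v -> normal_pdf b (Num.sqrt (2 * v)) t =
  (Num.sqrt (4 * v * pi))^-1 * expR (- ((t - b) ^+ 2 / (4 * v))).
Proof.
move=> v0; rewrite normal_pdfE ?gt_eqF ?sqrtr_gt0 ?mulr_gt0//.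
have v2 : Num.sqrt (2 * v) ^+ 2 = 2 * v by rewrite sqr_sqrtr// mulr_ge0// ltW.
rewrite /normal_peak /normal_fun v2; congr (_ * expR _).
  by congr ((Num.sqrt _)^-1); ring.
by field; rewrite gt_eqF.
Qed.

(** The bound on [kappa] in the definition of Theta is the reciprocal of the
    supremum of the ratio of the two normal densities; only the upper estimate of
    the ratio is needed. *)
Lemma theta_bound_pdf t : B * normal_pdf beta' h' t <= normal_pdf beta h t.
Proof.
rewrite !pdfE// /B /theta_bound.
have -> : (Num.sqrt (4 * sigma * pi))^-1 =
    Num.sqrt (sigma' / sigma) * (Num.sqrt (4 * sigma' * pi))^-1.
  have -> : 4 * sigma * pi = (sigma / sigma') * (4 * sigma' * pi).
    by field; rewrite gt_eqF.
  have -> : sigma' / sigma = (sigma / sigma')^-1 by rewrite invf_div.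
  rewrite sqrtrV ?divr_ge0 ?(ltW s0) ?(ltW s'0)//.
  by rewrite (sqrtrM (4 * sigma' * pi)) ?divr_ge0 ?(ltW s0) ?(ltW s'0)// invfM.
rewrite mulrACA -expRD; apply: ler_wpM2l.
  by rewrite mulr_ge0 ?sqrtr_ge0// invr_ge0 sqrtr_ge0.
rewrite ler_expR.
have ds : 0 < sigma - sigma' by rewrite subr_gt0.
have := sqrD_div_le (t - beta') (beta' - beta) s'0 ds.
rewrite subrKC [t - beta' + _](_ : _ = t - beta); last by ring.
have -> : (beta - beta') ^+ 2 / (4 * (sigma - sigma')) =
    (beta' - beta) ^+ 2 / (sigma - sigma') / 4.
  by field; rewrite gt_eqF.
have -> : (t - beta') ^+ 2 / (4 * sigma') = (t - beta') ^+ 2 / sigma' / 4.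
  by field; rewrite gt_eqF.
have -> : (t - beta) ^+ 2 / (4 * sigma) = (t - beta) ^+ 2 / sigma / 4.
  by field; rewrite gt_eqF.
lra.
Qed.

Let ratio t := normal_pdf beta' h' t / normal_pdf beta h t.

Let pdf_gt0 t : 0 < normal_pdf beta h t.
Proof.
by rewrite /h pdfE// mulr_gt0 ?expR_gt0// invr_gt0 sqrtr_gt0 !mulr_gt0 ?pi_gt0.
Qed.

Let B_gt0 : 0 < B.
Proof. by rewrite mulr_gt0 ?expR_gt0// sqrtr_gt0 divr_gt0. Qed.

Let ratio_ge0 t : 0 <= ratio t.
Proof. by rewrite divr_ge0 ?normal_pdf_ge0// ltW. Qed.

Let ratio_le t : ratio t <= B^-1.
Proof. by rewrite ler_pdivrMr// ler_pdivlMl// theta_bound_pdf. Qed.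

Let bounded_ratio : bounded_mfun (ratio : R -> R).
Proof.
split; last by exists B^-1 => t; rewrite ger0_norm.
apply: measurable_funM; first exact: measurable_normal_pdf.
apply: continuous_measurable_fun => t; apply: cvgV; first by rewrite gt_eqF.
by apply: continuous_normal_pdf; rewrite gt_eqF.
Qed.

(* The density with respect to the product of the wider normal law and the Haar
   law: its even part gives the marginal on [R], its odd part the second branch of
   the characteristic function. *)
Let g (x : RZ2 R) : R := 1 + (-1) ^+ x.2 * kappa * ratio x.1.

Let g_ge0 x : 0 <= g x.
Proof.
have : `|(-1) ^+ x.2 * kappa * ratio x.1| <= 1.
  rewrite normrM (ger0_norm (ratio_ge0 _)) normrM normrX normrN1 expr1n mul1r.
  apply: (@le_trans _ _ (B * B^-1)); last by rewrite divff// gt_eqF.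
  by rewrite ler_pM.
by move=> /ler_normlP[]; rewrite /g; lra.
Qed.

Let bounded_g : bounded_mfun g.
Proof.
apply: bounded_mfunD; first exact: bounded_mfun_cst.
apply: bounded_mfunM.
  apply: bounded_mfunM; last exact: bounded_mfun_cst.
  apply: (bounded_mfun_comp (h := snd) (f := fun k : bool => (-1) ^+ k : R)) => //.
  exact: bounded_mfun_bool.
by apply: (bounded_mfun_comp (h := fst)).
Qed.

Let base : M1 := (normal_law beta h \x @haarZ2 R)%E.

Let Rintegral_haar_g (P : probability R R) (f : R -> R) (l : bool) : bounded_mfun f ->
  \int[(P \x @haarZ2 R)%E]_x (f x.1 * (-1) ^+ (x.2 * l)%N * g x) =
  if l then kappa * \int[P]_t (f t * ratio t) else \int[P]_t f t.
Proof.
move=> bf.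
have bfg : bounded_mfun (fun x : RZ2 R => f x.1 * (-1) ^+ (x.2 * l)%N * g x).
  apply: bounded_mfunM => //; apply: bounded_mfunM; last exact: bounded_mfun_sign.
  by apply: (bounded_mfun_comp (h := fst)).
rewrite Rintegral_prod//.
have E t : \int[@haarZ2 R]_k (f t * (-1) ^+ (k * l)%N * g (t, k)) =
    f t * (if l then kappa * ratio t else 1).
  rewrite /haarZ2 Rintegral_bernoulli; last by apply/andP; split; lra.
  by rewrite /g/=; case: (l) => /=; field.
under eq_Rintegral do rewrite E.
case: l {bfg E} => /=; last by under eq_Rintegral do rewrite mulr1.
under eq_Rintegral do rewrite mulrCA.
rewrite RintegralZl//; apply: bounded_mfun_integrable; exact: bounded_mfunM.
Qed.

Let Rintegral_base_g (f : R -> R) (l : bool) : bounded_mfun f ->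
  \int[base]_x (f x.1 * (-1) ^+ (x.2 * l)%N * g x) =
  if l then kappa * \int[normal_law beta' h']_t f t else \int[normal_law beta h]_t f t.
Proof.
move=> bf; rewrite /base (Rintegral_haar_g _ l bf).
case: l; last by [].
have bfr : bounded_mfun (fun t => f t * ratio t) by exact: bounded_mfunM.
apply: (congr1 ( *%R kappa)).
apply: (etrans (Rintegral_normal_law_pdf _ _ bfr)).
apply: (etrans _ (esym (Rintegral_normal_law_pdf _ _ bf))).
apply: (congr1 (Rintegral _ _)); apply/funext => t.
by rewrite /ratio -mulrA divfK// gt_eqF.
Qed.

Let integral_g : (\int[base]_x (g x)%:E = 1)%E.
Proof.
have bg := bounded_mfun_integrable base bounded_g.
rewrite -[LHS]fineK; last exact: integrable_fin_num bg.
apply: (congr1 EFin).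
transitivity (\int[base]_x (cst 1 x.1 * (-1) ^+ (x.2 * false)%N * g x)).
  by apply: eq_Rintegral => x _; rewrite muln0 expr0 !mul1r.
rewrite (Rintegral_base_g false (bounded_mfun_cst _ 1)) Rintegral_cst// mul1r.
by rewrite [X in fine X](_ : _ = 1%E); last exact: probability_setT.
Qed.

Lemma theta_exists_lt :
  exists mu : M1, forall s l, chf mu s l = theta_chf sigma sigma' beta beta' kappa s l.
Proof.
exists (density_prob bounded_g.1 g_ge0 integral_g) => s l.
have dens f : bounded_mfun f -> \int[density_prob bounded_g.1 g_ge0 integral_g]_x f x =
    \int[base]_x (f x * g x).
  move=> bf; apply: Rintegral_density => //; exact: bounded_g.1.
have bc : bounded_mfun (fun t : R => cos (t * s)).
  apply: (bounded_mfun_comp (f := @cos R)); last exact: bounded_mfun_cos.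
  exact: measurable_funM.
have bs : bounded_mfun (fun t : R => sin (t * s)).
  apply: (bounded_mfun_comp (f := @sin R)); last exact: bounded_mfun_sin.
  exact: measurable_funM.
rewrite chfE !dens; [|exact: bounded_mfun_im|exact: bounded_mfun_re].
rewrite (Rintegral_base_g l bc) (Rintegral_base_g l bs).
have chfRE (b v : R) : 0 < v ->
  ((\int[normal_law b (Num.sqrt (2 * v))]_t cos (t * s)) +i*
   (\int[normal_law b (Num.sqrt (2 * v))]_t sin (t * s)))%C = gauss_chf v b s.
  move=> v0; have hv : 0 < Num.sqrt (2 * v) by rewrite sqrtr_gt0 mulr_gt0.
  have -> : gauss_chf v b s = gauss_chf (Num.sqrt (2 * v) ^+ 2 / 2) b s.
    by rewrite sqr_sqrtr ?mulr_ge0 ?(ltW v0)// mulrAC divff// mul1r.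
  rewrite -chfR_normal_law// /chfR /cintegral.
  by congr (_ +i* _)%C; apply: eq_Rintegral => t _; rewrite cexpi.
rewrite /theta_chf; case: l; last exact: chfRE.
rewrite -chfRE//; apply/eqP; rewrite eq_complex/= !mul0r subr0 addr0.
by rewrite !eqxx.
Qed.

End LessSpread.
End Existence.

(** * Arithmetic of the parameters *)

Section ThetaLaws.
Context (R : realType).
Local Notation M1 := (probability (RZ2 R) R).
Implicit Types (mu nu : M1) (sigma beta kappa s b k a : R) (l : bool).

Lemma gauss_chfD s1 s2 b1 b2 s : gauss_chf s1 b1 s * gauss_chf s2 b2 s =
  gauss_chf (s1 + s2) (b1 + b2) s :> complex R.
Proof.
rewrite !gauss_chfE mulrDl opprD expRD mulrDl cosD sinD.
by apply/eqP; rewrite eq_complex/=; apply/andP; split; apply/eqP; ring.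
Qed.

Lemma gauss_chf00 sigma beta : gauss_chf sigma beta 0 = 1.
Proof.
by rewrite gauss_chfE expr0n/= !mulr0 oppr0 expR0 cos0 sin0 !mul1r.
Qed.

(** The modulus at a single point gives the variance; the phases then agree
    everywhere, and evaluating at [pi] over their difference excludes distinct
    means. *)
Lemma gauss_chf_inj s1 s2 b1 b2 :
  (forall s, gauss_chf s1 b1 s = gauss_chf s2 b2 s) -> s1 = s2 /\ b1 = b2.
Proof.
move=> E.
have Ere s : expR (- (s1 * s ^+ 2)) * cos (b1 * s) = expR (- (s2 * s ^+ 2)) * cos (b2 * s).
  by have := E s; rewrite !gauss_chfE => -[].
have Eim s : expR (- (s1 * s ^+ 2)) * sin (b1 * s) = expR (- (s2 * s ^+ 2)) * sin (b2 * s).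
  by have := E s; rewrite !gauss_chfE => -[].
have s12 : s1 = s2.
  have : expR (- (s1 * 1 ^+ 2)) ^+ 2 = expR (- (s2 * 1 ^+ 2)) ^+ 2 :> R.
    have sq a c : expR a ^+ 2 = (expR a * cos c) ^+ 2 + (expR a * sin c) ^+ 2 :> R.
      by rewrite !exprMn -mulrDr cos2Dsin2 mulr1.
    by rewrite [LHS](sq _ (b1 * 1)) [RHS](sq _ (b2 * 1)) Ere Eim.
  move/eqP; rewrite eqrXn2 ?expR_ge0// => /eqP /expR_inj.
  by rewrite expr1n !mulr1 => /oppr_inj.
split=> //; apply: contrapT => /eqP b12.
have d0 : b1 - b2 != 0 by rewrite subr_eq0.
pose s := pi / (b1 - b2) : R.
have cs : cos (b1 * s) = cos (b2 * s).
  by have := Ere s; rewrite s12 => /(mulfI (lt0r_neq0 (expR_gt0 _))).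
have ss : sin (b1 * s) = sin (b2 * s).
  by have := Eim s; rewrite s12 => /(mulfI (lt0r_neq0 (expR_gt0 _))).
have : cos (b1 * s - b2 * s) = 1 by rewrite cosB cs ss -!expr2 cos2Dsin2.
by rewrite -mulrBl /s mulrCA divff// mulr1 cospi; lra.
Qed.

Lemma theta_chfM s1 s1' b1 b1' k1 s2 s2' b2 b2' k2 s l :
  theta_chf s1 s1' b1 b1' k1 s l * theta_chf s2 s2' b2 b2' k2 s l =
  theta_chf (s1 + s2) (s1' + s2') (b1 + b2) (b1' + b2') (k1 * k2) s l :> complex R.
Proof.
case: l; rewrite /theta_chf ?gauss_chfD//.
by rewrite mulrACA gauss_chfD -rmorphM.
Qed.

Lemma theta_chf_kappa0 sigma a beta b a' b' s l :
  theta_chf sigma a beta b 0 s l = theta_chf sigma a' beta b' 0 s l :> complex R.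
Proof. by case: l; rewrite /theta_chf// !mul0r. Qed.

(** When [kappa] vanishes the second branch is zero and carries no information on
    its Gaussian parameters. The case [kappa = 0] is the source of the exceptional
    laws in the description of the laws without indecomposable factors. *)
Lemma theta_chf_inj s1 s1' b1 b1' k1 s2 s2' b2 b2' k2 :
  (forall s l, theta_chf s1 s1' b1 b1' k1 s l = theta_chf s2 s2' b2 b2' k2 s l) ->
  [/\ s1 = s2, b1 = b2, k1 = k2 & k1 != 0 -> s1' = s2' /\ b1' = b2'].
Proof.
move=> E; have [s12 b12] := gauss_chf_inj (fun s => E s false).
have k12 : k1 = k2.
  by have := E 0 true; rewrite /theta_chf !gauss_chf00 !mulr1 => -[].
split=> // k0; apply: gauss_chf_inj => s.
have := E s true; rewrite /theta_chf -k12; apply: mulfI.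
by apply: contra_neq k0 => -[].
Qed.

Definition theta_law mu (sigma sigma' beta beta' kappa : R) :=
  forall s l, chf mu s l = theta_chf sigma sigma' beta beta' kappa s l.

(** The condition on parameters defining Theta. *)
Definition theta_admissible (sigma sigma' beta beta' kappa : R) :=
  (0 < sigma' < sigma /\ 0 < `|kappa| <= theta_bound sigma sigma' beta beta') \/
  [/\ sigma = sigma', beta = beta' & `|kappa| <= 1].

Lemma ThetaP mu : Theta mu <-> exists sigma sigma' beta beta' kappa,
  [/\ 0 <= sigma, theta_admissible sigma sigma' beta beta' kappa &
      theta_law mu sigma sigma' beta beta' kappa].
Proof.
split=> -[s [s' [b [b' [k]]]]].
  by move=> [s0 s'0 law adm]; exists s, s', b, b', k.
move=> [s0 adm law]; exists s, s', b, b', k; split => //.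
by case: adm => [[/andP[/ltW]]|[<-]].
Qed.

Lemma theta_exists sigma sigma' beta beta' kappa : 0 <= sigma ->
  theta_admissible sigma sigma' beta beta' kappa ->
  exists2 mu, Theta mu & theta_law mu sigma sigma' beta beta' kappa.
Proof.
move=> s0 adm.
have [mu law] : exists mu, theta_law mu sigma sigma' beta beta' kappa.
  case: adm => [[/andP[s'0 ss'] /andP[_ kB]]|[<- <- k1]].
    exact: theta_exists_lt.
  exact: theta_exists_eq.
by exists mu => //; apply/ThetaP; exists sigma, sigma', beta, beta', kappa.
Qed.

Lemma theta_lawM mu nu s1 s1' b1 b1' k1 s2 s2' b2 b2' k2 :
  theta_law mu s1 s1' b1 b1' k1 -> theta_law nu s2 s2' b2 b2' k2 ->
  theta_law (convol mu nu) (s1 + s2) (s1' + s2') (b1 + b2) (b1' + b2') (k1 * k2).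
Proof. by move=> m n s l; rewrite chf_convol m n theta_chfM. Qed.

Lemma theta_law_eq mu nu s s' b b' k :
  theta_law mu s s' b b' k -> theta_law nu s s' b b' k -> mu ≡μ nu.
Proof. by move=> m n; apply: chf_inj => t l; rewrite m n. Qed.

Lemma theta_law_inj mu nu s1 s1' b1 b1' k1 s2 s2' b2 b2' k2 : mu ≡μ nu ->
  theta_law mu s1 s1' b1 b1' k1 -> theta_law nu s2 s2' b2 b2' k2 ->
  [/\ s1 = s2, b1 = b2, k1 = k2 & k1 != 0 -> s1' = s2' /\ b1' = b2'].
Proof.
move=> mn m n; apply: theta_chf_inj => s l.
by rewrite -m -n (chf_measure_eq mn).
Qed.

Lemma theta_law_dirac (x : RZ2 R) :
  theta_law (\d_x : M1) 0 0 x.1 x.1 ((-1) ^+ x.2).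
Proof.
move=> s l; rewrite chf_dirac /theta_chf !gauss_chf0 [x.1 * s]mulrC.
case: l; rewrite /= ?muln0 ?expr0 ?mulr1// muln1 mulrC ![s * _]mulrC.
by rewrite rmorphXn rmorphN1.
Qed.

Lemma degenerate_theta_law mu s s' b b' k :
  theta_law mu s s' b b' k -> degenerate mu -> s = 0 /\ `|k| = 1.
Proof.
move=> law [x mx]; have [-> _ -> _] := theta_law_inj mx law (theta_law_dirac x).
by rewrite normrX normrN1 expr1n.
Qed.

Lemma sign_of_norm1 (k : R) : `|k| = 1 -> (-1) ^+ (k < 0)%R = k.
Proof. by move=> k1; rewrite [RHS](realEsign (num_real k)) k1 mulr1. Qed.

Lemma theta_law_degenerate mu b k :
  theta_law mu 0 0 b b k -> `|k| = 1 -> mu ≡μ (\d_((b, k < 0) : RZ2 R) : M1).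
Proof.
move=> law k1; apply: (theta_law_eq law).
by have := @theta_law_dirac (b, k < 0); rewrite /= sign_of_norm1.
Qed.

Lemma shift_theta_law mu nu s s' b b' k : theta_law mu s s' b b' k ->
  is_shift mu nu -> exists t, exists2 k', `|k'| = `|k| & theta_law nu s s' (b + t) (b' + t) k'.
Proof.
move=> law [x nx]; exists x.1, (k * (-1) ^+ x.2).
  by rewrite normrM normrX normrN1 expr1n mulr1.
move=> u l; rewrite (chf_measure_eq nx).
by have := theta_lawM law (theta_law_dirac x) u l; rewrite !addr0.
Qed.

Lemma theta_law_pow mu s s' b b' k n : theta_law mu s s' b b' k ->
  theta_law (convol_pow mu n) (n%:R * s) (n%:R * s') (n%:R * b) (n%:R * b') (k ^+ n).
Proof.
move=> law; elim: n => [|n IH].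
  by rewrite !mul0r expr0; exact: (theta_law_dirac 0).
have := theta_lawM IH law; rewrite /convol_pow -/convol_pow exprSr.
by rewrite -!natr1 !mulrDl !mul1r.
Qed.

End ThetaLaws.

Section Bounds.
Context (R : realType).
Implicit Types (s b : R).

Lemma theta_bound_gt0 s s' b b' : 0 < s' -> s' < s -> 0 < theta_bound s s' b b'.
Proof.
move=> s'0 ss'; rewrite /theta_bound mulr_gt0 ?expR_gt0// sqrtr_gt0 divr_gt0//.
exact: lt_trans ss'.
Qed.

Lemma theta_bound_le_sqrt s s' b b' : s' < s -> theta_bound s s' b b' <= Num.sqrt (s' / s).
Proof.
move=> ss'; rewrite /theta_bound ler_piMr ?sqrtr_ge0// -expR0 ler_expR oppr_le0.
by rewrite divr_ge0 ?sqr_ge0// mulr_ge0// subr_ge0 ltW.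
Qed.

Lemma sqrt_ratio_lt1 s s' : 0 < s' -> s' < s -> Num.sqrt (s' / s) < 1.
Proof.
move=> s'0 ss'; have s0 : 0 < s by exact: lt_trans ss'.
by rewrite -[ltRHS]sqrtr1 ltr_sqrt// ltr_pdivrMr ?mul1r.
Qed.

(** The exponents are superadditive by convexity, and strictness comes from the
    square roots: a product of two numbers below 1 lies below both, hence below
    their mediant. *)
Lemma theta_bound_mul_lt s1 s1' b1 b1' s2 s2' b2 b2' :
  0 < s1' -> s1' < s1 -> 0 < s2' -> s2' < s2 ->
  theta_bound s1 s1' b1 b1' * theta_bound s2 s2' b2 b2' <
  theta_bound (s1 + s2) (s1' + s2') (b1 + b2) (b1' + b2').
Proof.
move=> s1'0 s1s s2'0 s2s; rewrite /theta_bound mulrACA.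
have s10 : 0 < s1 by exact: lt_trans s1s.
have s20 : 0 < s2 by exact: lt_trans s2s.
have d1 : 0 < s1 - s1' by rewrite subr_gt0.
have d2 : 0 < s2 - s2' by rewrite subr_gt0.
have e : expR (- ((b1 - b1') ^+ 2 / (4 * (s1 - s1')))) *
    expR (- ((b2 - b2') ^+ 2 / (4 * (s2 - s2')))) <=
    expR (- ((b1 + b2 - (b1' + b2')) ^+ 2 / (4 * (s1 + s2 - (s1' + s2'))))).
  rewrite -expRD ler_expR.
  have := sqrD_div_le (b1 - b1') (b2 - b2') d1 d2.
  have -> : b1 + b2 - (b1' + b2') = b1 - b1' + (b2 - b2') by ring.
  have -> : s1 + s2 - (s1' + s2') = s1 - s1' + (s2 - s2') by ring.
  by rewrite !invfM !mulrA !(mulrAC _ 4^-1); lra.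
have q : Num.sqrt (s1' / s1) * Num.sqrt (s2' / s2) < Num.sqrt ((s1' + s2') / (s1 + s2)).
  rewrite -sqrtrM ?divr_ge0 ?ltW// ltr_sqrt ?divr_gt0 ?addr_gt0//.
  rewrite ltr_pdivlMr ?addr_gt0//.
  have -> : s1' / s1 * (s2' / s2) * (s1 + s2) = s1' * (s2' / s2) + s2' * (s1' / s1).
    by field; rewrite !gt_eqF.
  by apply: ltrD; rewrite gtr_pMr// ltr_pdivrMr ?mul1r.
apply: (le_lt_trans (ler_wpM2l _ e)); first by rewrite mulr_ge0 ?sqrtr_ge0.
by rewrite ltr_pM2r ?expR_gt0.
Qed.

(** Adding the same positive amount to numerator and denominator increases a ratio
    below 1, while the exponent depends on differences only. *)
Lemma theta_bound_add_lt s0 s s' b0 b b' : 0 < s0 -> 0 < s' -> s' < s ->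
  theta_bound s s' b b' < theta_bound (s0 + s) (s0 + s') (b0 + b) (b0 + b').
Proof.
move=> s00 s'0 ss'; have sp : 0 < s by exact: lt_trans ss'.
rewrite /theta_bound.
have -> : b0 + b - (b0 + b') = b - b' by ring.
have -> : s0 + s - (s0 + s') = s - s' by ring.
rewrite ltr_pM2r ?expR_gt0// ltr_sqrt ?divr_gt0 ?addr_gt0//.
rewrite ltr_pdivrMr// mulrAC ltr_pdivlMr ?addr_gt0//.
by rewrite mulrDr mulrDl [s' * s0]mulrC ltrD2r ltr_pM2l.
Qed.

End Bounds.

(** * Indecomposable laws *)

Section Classes.
Context (R : realType).
Local Notation M1 := (probability (RZ2 R) R).
Implicit Types (mu nu : M1) (sigma beta kappa s b k : R).

Lemma admissible_eq s b k : `|k| <= 1 -> theta_admissible s s b b k.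
Proof. by right. Qed.

Lemma two_point_exists k : `|k| <= 1 -> exists2 mu, Theta mu & theta_law mu 0 0 0 0 k.
Proof. by move=> k1; apply: theta_exists => //; exact: admissible_eq. Qed.

Lemma is_factor_theta mu mu1 s1 s1' b1 b1' k1 s2 s2' b2 b2' k2 :
  theta_law mu (s1 + s2) (s1' + s2') (b1 + b2) (b1' + b2') (k1 * k2) ->
  Theta mu1 -> theta_law mu1 s1 s1' b1 b1' k1 ->
  0 <= s2 -> theta_admissible s2 s2' b2 b2' k2 ->
  is_factor Theta mu mu1.
Proof.
move=> law T1 law1 s20 adm2; split => //.
have [mu2 T2 law2] := theta_exists s20 adm2.
exists mu2; split => //; apply: (theta_law_eq law); exact: theta_lawM.
Qed.

(** A factor carried by Z(2) has no Gaussian part, so it cannot be a shift of a law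
    with [s != 0]; an indecomposable law therefore only splits off degenerate
    ones. *)
Lemma Ind_two_point_factor mu s s' b b' k1 k2 : 0 <= s ->
  theta_law mu s s' b b' (k1 * k2) -> theta_admissible s s' b b' k1 -> `|k2| <= 1 ->
  Ind Theta mu -> `|k2| = 1 \/ s = 0 /\ `|k2| = `|k1 * k2|.
Proof.
move=> s0 law adm1 k21 [_ _ ind].
have [om Tom lom] := two_point_exists k21.
have fac : is_factor Theta mu om.
  apply: (@is_factor_theta _ _ 0 0 0 0 k2 s s' b b' k1) => //.
  by rewrite !add0r mulrC.
case: (ind _ fac) => [/(degenerate_theta_law lom)[]|]; first by left.
move=> /(shift_theta_law law)[t [k' kk' law']]; right.
have [] := theta_law_inj (fun A _ => erefl (om A)) lom law'.
by move=> <- _ k2E _; rewrite {1}k2E.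
Qed.

(** Outside the extreme case a nontrivial factor is always available: the two-point
    law that absorbs the slack in [kappa], or half of the Gaussian part, or, for
    laws on a translate of Z(2), a two-point law less spread than the given
    one. *)
Lemma Ind_theta_law mu : Ind Theta mu -> exists sigma sigma' beta beta' kappa : R,
  [/\ theta_law mu sigma sigma' beta beta' kappa, 0 < sigma' < sigma &
      `|kappa| = theta_bound sigma sigma' beta beta'].
Proof.
move=> indmu; have [Tmu ndeg ind] := indmu.
have [s [s' [b [b' [k [s0 adm law]]]]]] := (ThetaP mu).1 Tmu.
case: adm => [[/andP[s'0 ss'] /andP[k0 kB]]|[ss' bb' k1]].
  exists s, s', b, b', k; split => //; first by rewrite s'0.
  set B := theta_bound s s' b b' in kB *.
  have B0 : 0 < B by exact: theta_bound_gt0.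
  have law' : theta_law mu s s' b b' (B * (k / B)) by rewrite mulrC divfK// gt_eqF.
  have admB : theta_admissible s s' b b' B.
    by left; rewrite s'0 ss' gtr0_norm// B0 lexx.
  have kB1 : `|k / B| <= 1 by rewrite normrM normfV (gtr0_norm B0) ler_pdivrMr ?mul1r.
  have [|[s00 _]] := Ind_two_point_factor s0 law' admB kB1 indmu.
    rewrite normrM normfV (gtr0_norm B0) => /(congr1 ( *%R^~ B)).
    by rewrite divfK ?gt_eqF// mul1r.
  by have := lt_trans s'0 ss'; rewrite s00 ltxx.
exfalso; subst s' b'.
move: (s0); rewrite le_eqVlt => /predU1P[s00|sp]; last first.
  have sh : 0 <= s / 2 by rewrite divr_ge0.
  have n1 : `|1| <= 1 :> R by rewrite normr1.
  have [mu1 T1 law1] := theta_exists sh (@admissible_eq (s / 2) b 1 n1).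
  have fac : is_factor Theta mu mu1.
    apply: (@is_factor_theta _ _ (s / 2) (s / 2) b b 1 (s / 2) (s / 2) 0 0 k) => //.
      by rewrite -splitr addr0 mul1r.
    exact: admissible_eq.
  case: (ind _ fac) => [/(degenerate_theta_law law1)[s20 _]|]; first by lra.
  move=> /(shift_theta_law law)[t [k' _ law']].
  by have [E _ _ _] := theta_law_inj (fun A _ => erefl (mu1 A)) law1 law'; lra.
rewrite -s00 in law.
have k1lt : `|k| < 1.
  rewrite lt_neqAle k1 andbT; apply/eqP => kE; apply: ndeg.
  by exists (b, k < 0); exact: theta_law_degenerate.
(* Any value strictly between [`|k|] and 1 gives a factor that is neither degenerate
   nor a shift. *)
pose c := (1 + `|k|) / 2.
have k0 : 0 <= `|k| by [].
have c0 : 0 < c by rewrite /c; lra.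
have law' : theta_law mu 0 0 b b (k / c * c) by rewrite divfK// gt_eqF.
have kc1 : `|k / c| <= 1.
  by rewrite normrM normfV (gtr0_norm c0) ler_pdivrMr// mul1r /c; lra.
have c1 : `|c| <= 1 by rewrite gtr0_norm// /c; lra.
have := Ind_two_point_factor (lexx 0) law' (@admissible_eq 0 b _ kc1) c1 indmu.
rewrite divfK ?gt_eqF// gtr0_norm// /c; lra.
Qed.

(** In a factorisation of an extreme law with one factor of equal variances, that
    factor must have variance 0, or the bound of the product would strictly exceed
    [`|k1 * k2|]. *)
Lemma extreme_degenerate_factor s1 b1 k1 s2 s2' b2 b2' k2 :
  0 <= s1 -> `|k1| <= 1 -> 0 < s2' -> s2' < s2 ->
  0 < `|k2| -> `|k2| <= theta_bound s2 s2' b2 b2' ->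
  `|k1 * k2| = theta_bound (s1 + s2) (s1 + s2') (b1 + b2) (b1 + b2') ->
  s1 = 0 /\ `|k1| = 1.
Proof.
move=> s10 k11 s2'0 ss2 k20 k2B; rewrite normrM => kB.
have kk : `|k1| * `|k2| <= theta_bound s2 s2' b2 b2'.
  by rewrite -[leRHS]mul1r ler_pM.
have s100 : s1 = 0.
  apply/eqP; rewrite eq_le s10 andbT leNgt; apply/negP => s1p.
  have := theta_bound_add_lt b1 b2 b2' s1p s2'0 ss2.
  by rewrite -kB ltNge kk.
split=> //; apply/eqP; rewrite eq_le k11 -(ler_pM2r k20) mul1r kB s100.
rewrite /theta_bound !add0r (_ : b1 + b2 - (b1 + b2') = b2 - b2'); first exact: k2B.
by rewrite opprD addrACA subrr add0r.
Qed.

(** Two factors of unequal variances would give [`|kappa|] strictly below the bound,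
    and two of equal variances would give [sigma = sigma']; so exactly one factor has
    equal variances and it is degenerate. *)
Lemma theta_law_Ind mu sigma sigma' beta beta' kappa :
  theta_law mu sigma sigma' beta beta' kappa -> 0 < sigma' < sigma ->
  `|kappa| = theta_bound sigma sigma' beta beta' -> Ind Theta mu.
Proof.
move=> law /andP[s'0 ss'] kB.
have B0 : 0 < theta_bound sigma sigma' beta beta' by exact: theta_bound_gt0.
have s0 : 0 < sigma by exact: lt_trans ss'.
have k0 : kappa != 0 by rewrite -normr_gt0 kB.
split.
- apply/ThetaP; exists sigma, sigma', beta, beta', kappa; split => //; first exact: ltW.
  by left; rewrite s'0 ss' kB B0 lexx.
- by move=> /(degenerate_theta_law law)[E _]; rewrite E ltxx in s0.
move=> mu1 [T1 [mu2 [T2 mu12]]].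
have [s1 [s1' [b1 [b1' [k1 [s10 adm1 law1]]]]]] := (ThetaP mu1).1 T1.
have [s2 [s2' [b2 [b2' [k2 [s20 adm2 law2]]]]]] := (ThetaP mu2).1 T2.
have [sE bE kE /(_ k0)[s'E b'E]] := theta_law_inj mu12 law (theta_lawM law1 law2).
subst sigma sigma' beta beta' kappa; rewrite normrM in kB.
case: adm1 => [[/andP[s1'0 ss1] /andP[k10 k1B]]|[E1 E1' k11]];
  case: adm2 => [[/andP[s2'0 ss2] /andP[k20 k2B]]|[E2 E2' k21]].
- have := theta_bound_mul_lt b1 b1' b2 b2' s1'0 ss1 s2'0 ss2.
  by rewrite -kB ltNge ler_pM.
- subst s2' b2'; right.
  have [s200 k2E] : s2 = 0 /\ `|k2| = 1.
    apply: (@extreme_degenerate_factor s2 b2 k2 s1 s1' b1 b1' k1) => //.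
    by rewrite normrM mulrC kB; congr theta_bound; exact: addrC.
  subst s2; exists (- b2, (k2 < 0)).
  apply: (theta_law_eq law1).
  have := theta_lawM law (theta_law_dirac (- b2, (k2 < 0))).
  rewrite /= sign_of_norm1// !addr0 !addrK.
  rewrite -mulrA -expr2 -(real_normK (num_real k2)) k2E expr1n mulr1; exact.
- subst s1' b1'; left.
  have [s100 k1E] : s1 = 0 /\ `|k1| = 1.
    by apply: (@extreme_degenerate_factor s1 b1 k1 s2 s2' b2 b2' k2) => //;
      rewrite normrM.
  by subst s1; exists (b1, (k1 < 0)); exact: theta_law_degenerate.
- exfalso; lra.
Qed.

End Classes.

(** * Infinitely divisible laws and laws without indecomposable factors *)

Section Divisibility.
Context (R : realType).
Local Notation M1 := (probability (RZ2 R) R).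
Implicit Types (mu nu : M1) (sigma beta kappa s b k : R).

Lemma gauss_convolP mu : gauss_convol_M1Z2 mu <->
  exists s b k, [/\ 0 <= s, `|k| <= 1 & theta_law mu s s b b k].
Proof.
split=> [[gamma [omega [[s [b [s0 E]]] muE]]]|[s [b [k [s0 k1 law]]]]].
  exists s, b, (sign_mean omega); split => //; first exact: sign_mean_le1.
  by move=> u l; rewrite (chf_measure_eq muE) (chf_gauss_convol _ _ _ E).
have [gamma E] := gaussian_exists b s0.
exists gamma, (bernoulli_prob ((1 - k) / 2)); split; first by exists s, b.
apply: (theta_law_eq law) => u l.
by rewrite (chf_gauss_convol _ _ _ E) sign_mean_bernoulli.
Qed.

Lemma Theta_gauss_convol mu : gauss_convol_M1Z2 mu -> Theta mu.
Proof.
move=> /gauss_convolP[s [b [k [s0 k1 law]]]].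
by apply/ThetaP; exists s, s, b, b, k; split => //; exact: admissible_eq.
Qed.

(** An n-th root has the same ratio of variances as [mu], and the n-th root of
    [`|k|] is bounded by the square root of that ratio. If the ratio is below 1,
    letting n grow forces [k = 0], which admissibility excludes. *)
Lemma InfDiv_gauss_convol mu : InfDiv Theta mu -> gauss_convol_M1Z2 mu.
Proof.
move=> [Tmu div].
have [s [s' [b [b' [k [s0 adm law]]]]]] := (ThetaP mu).1 Tmu.
case: adm => [[/andP[s'0 ss'] /andP[k0 kB]]|[E E' k1]]; last first.
  by subst s' b'; apply/gauss_convolP; exists s, b, k.
exfalso; pose r := Num.sqrt (s' / s).
have r1 : `|r| < 1 by rewrite ger0_norm ?sqrtr_ge0// sqrt_ratio_lt1.
have kr n : (0 < n)%N -> `|k| <= r ^+ n.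
  move=> n0; have [nu [x [Tnu muE]]] := div n n0.
  have [t [t' [c [c' [j [t0 admt lawt]]]]]] := (ThetaP nu).1 Tnu.
  have kn0 : k != 0 by rewrite -normr_gt0.
  have := theta_law_inj muE law (theta_lawM (theta_law_pow n lawt) (theta_law_dirac x)).
  rewrite !addr0 => -[sE _ kE /(_ kn0)[s'E _]].
  have np : 0 < n%:R :> R by rewrite ltr0n.
  have tt' : t' < t by rewrite -(ltr_pM2l np) -sE -s'E.
  case: admt => [[/andP[t'0 _] /andP[j0 jB]]|[E _ _]]; last by rewrite E ltxx in tt'.
  have rE : r = Num.sqrt (t' / t).
    by rewrite /r sE s'E invfM mulrACA divff ?mul1r// gt_eqF.
  rewrite kE normrM !normrX normrN1 expr1n mulr1 rE.
  apply: lerXn2r; rewrite ?nnegrE ?sqrtr_ge0//.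
  exact: le_trans jB (theta_bound_le_sqrt _ _ tt').
have /(cvgr_lt _ (cvg_expr r1)) : 0 < `|k| by [].
move=> [N _ rN].
have := rN N.+1 (leqnSn N); have := kr N.+1 isT.
by rewrite /= ltNge => ->.
Qed.

Lemma root_exists k n : (0 < n)%N -> 0 <= k <= 1 ->
  exists2 c : R, 0 <= c <= 1 & c ^+ n = k.
Proof.
move=> n0 /andP[k0 k1]; exists (k `^ n%:R^-1).
  rewrite powR_ge0/=.
  rewrite [leRHS](_ : 1 = 1 `^ n%:R^-1); last by rewrite powR1.
  by apply: ge0_ler_powR; rewrite ?nnegrE ?invr_ge0.
rewrite -powR_mulrn ?powR_ge0// -powRrM mulVf ?powRr1//.
by rewrite pnatr_eq0 -lt0n.
Qed.

Lemma gauss_convol_InfDiv mu : gauss_convol_M1Z2 mu -> InfDiv Theta mu.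
Proof.
move=> gmu; split; first exact: Theta_gauss_convol.
move: gmu => /gauss_convolP[s [b [k [s0 k1 law]]]] n n0.
have k01 : 0 <= `|k| <= 1 by rewrite normr_ge0.
have [c /andP[c0 c1] cn] := root_exists n0 k01.
have sn : 0 <= s / n%:R by rewrite divr_ge0.
have cn1 : `|c| <= 1 by rewrite ger0_norm.
have [nu Tnu lawn] := theta_exists sn (@admissible_eq _ (s / n%:R) (b / n%:R) _ cn1).
exists nu, (0, (k < 0)); split => //; apply: (theta_law_eq law).
have := theta_lawM (theta_law_pow n lawn) (theta_law_dirac (0, (k < 0))).
rewrite /= !addr0 cn ![n%:R * _]mulrC !divfK ?pnatr_eq0 -?lt0n//.
by rewrite mulrC -(realEsign (num_real k)).
Qed.

(** Degeneracy is read on characteristic functions after embedding the law into the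
    product group, where uniqueness is available. *)
Lemma gaussian_degenerate (gamma : probability R R) s b :
  (forall u, chfR gamma u = gauss_chf s b u) -> s = 0 <-> degenerate gamma.
Proof.
move=> E; have lawR : theta_law (ofR gamma) s s b b 1.
  by move=> u l; rewrite chf_ofR E /theta_chf mul1r; case: l.
split=> [s0|[x gx]].
  subst s; exists b => A mA.
  have mAT : measurable (A `*` [set: bool]) by exact: measurableX.
  transitivity (ofR gamma (A `*` setT)).
    rewrite [RHS]/(gamma (@injR R @^-1` (A `*` setT))); congr (gamma _).
    by apply/seteqP; split => t //= -[].
  rewrite (theta_law_degenerate lawR (normr1 R) mAT) [LHS]diracE [RHS]diracE.
  congr ((nat_of_bool _)%:R%:E).
  by apply/idP/idP; rewrite !inE => //= -[].
have : degenerate (ofR gamma).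
  exists (x, false) => A mA.
  have mA' : measurable (@injR R @^-1` A).
    by rewrite -[X in measurable X]setTI; exact: measurable_injR.
  apply: (etrans (gx _ mA')).
  by rewrite [LHS]diracE [RHS]diracE.
by move=> /(degenerate_theta_law lawR)[].
Qed.

(** Since [kappa = 0], the variance of the second branch is invisible, and an extreme
    law with the same [sigma] and half of it as [sigma'] is a factor: its complement
    is a translate of the Haar law. *)
Lemma I0_not_gauss_haar mu (gamma : probability R R) : gaussian gamma ->
  ~ degenerate gamma -> mu ≡μ convol (ofR gamma) (ofZ2 haarZ2) -> ~ I0 Theta mu.
Proof.
move=> [s [b [s0 E]]] ndeg muE [_ noInd].
have sp : 0 < s.
  by rewrite lt_neqAle s0 andbT eq_sym; apply/eqP => /(gaussian_degenerate E).1.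
have law : theta_law mu s s b b 0.
  by move=> u l; rewrite (chf_measure_eq muE) (chf_gauss_convol _ _ _ E) sign_mean_haar.
pose B : R := theta_bound s (s / 2) 0 0.
have s2 : 0 < s / 2 by rewrite divr_gt0.
have ss2 : s / 2 < s by lra.
have B0 : 0 < B by exact: theta_bound_gt0.
have admB : theta_admissible s (s / 2) 0 0 B.
  by left; rewrite s2 ss2 gtr0_norm// B0 lexx.
have [mu1 T1 law1] := theta_exists s0 admB.
apply: noInd; exists mu1; last first.
  by apply: (theta_law_Ind law1); rewrite ?s2// gtr0_norm.
have n0 : `|0 : R| <= 1 by rewrite normr0 ler01.
apply: (@is_factor_theta _ _ mu1 s (s / 2) 0 0 B 0 0 b b 0) => //.
  by move=> u l; rewrite law !addr0 !add0r mulr0; exact: theta_chf_kappa0.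
exact: admissible_eq.
Qed.

(** A law of unequal variances is the product of the extreme law with the same
    Gaussian parameters and of a two-point law, so it has an indecomposable
    factor. *)
Lemma I0_gauss_convol mu : I0 Theta mu -> gauss_convol_M1Z2 mu.
Proof.
move=> [Tmu noInd].
have [s [s' [b [b' [k [s0 adm law]]]]]] := (ThetaP mu).1 Tmu.
case: adm => [[/andP[s'0 ss'] /andP[k0 kB]]|[E E' k1]]; last first.
  by subst s' b'; apply/gauss_convolP; exists s, b, k.
exfalso; set B := theta_bound s s' b b' in kB.
have B0 : 0 < B by exact: theta_bound_gt0.
have admB : theta_admissible s s' b b' B.
  by left; rewrite s'0 ss' gtr0_norm// B0 lexx.
have [mu1 T1 law1] := theta_exists s0 admB.
apply: noInd; exists mu1; last first.
  by apply: (theta_law_Ind law1); rewrite ?s'0// gtr0_norm.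
have kB1 : `|k / B| <= 1 by rewrite normrM normfV (gtr0_norm B0) ler_pdivrMr ?mul1r.
apply: (@is_factor_theta _ _ mu1 s s' b b' B 0 0 0 0 (k / B)) => //.
  by rewrite !addr0 mulrC divfK// gt_eqF.
exact: admissible_eq.
Qed.

(** Every law of Theta has [s' <= s], and an indecomposable one has [s' < s]. So no
    product having an indecomposable factor can have equal variances, unless
    [kappa = 0] hides the second one; the product is then Gaussian times Haar,
    with positive variance. *)
Lemma gauss_convol_I0 mu : gauss_convol_M1Z2 mu ->
  ~ (exists gamma : probability R R,
       [/\ gaussian gamma, ~ degenerate gamma &
           mu ≡μ convol (ofR gamma) (ofZ2 haarZ2)]) -> I0 Theta mu.
Proof.
move=> gmu nhaar; split; first exact: Theta_gauss_convol.
move=> [mu1 [T1 [mu2 [T2 mu12]]] /Ind_theta_law].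
move=> [s1 [s1' [b1 [b1' [k1 [law1 /andP[s1'0 ss1] _]]]]]].
have [s2 [s2' [b2 [b2' [k2 [s20 adm2 law2]]]]]] := (ThetaP mu2).1 T2.
have s10 : 0 < s1 by exact: lt_trans ss1.
have ss2 : s2' <= s2 by case: adm2 => [[/andP[_ /ltW]]|[->]].
move: gmu => /gauss_convolP[s [b [k [s0 _ law]]]].
have [sE bE kE] := theta_law_inj mu12 law (theta_lawM law1 law2).
have [k0 _|kn0 /(_ isT)[s'E _]] := eqVneq k 0; last lra.
apply: nhaar; have [gamma E] := gaussian_exists b s0.
exists gamma; split; first by exists s, b.
  by move=> /(gaussian_degenerate E).2; lra.
apply: (theta_law_eq law) => u l.
by rewrite (chf_gauss_convol _ _ _ E) sign_mean_haar k0.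
Qed.

End Divisibility.

Theorem theorem3p7 (R : realType) :
  [/\ (* 1 *)
      InfDiv Theta = gauss_convol_M1Z2 :> set (probability (RZ2 R) R),
      (* 2 *)
      forall mu : probability (RZ2 R) R,
        I0 Theta mu <->
        gauss_convol_M1Z2 mu /\
        ~ (exists gamma : probability R R,
             [/\ gaussian gamma, ~ degenerate gamma &
                 mu ≡μ convol (ofR gamma) (ofZ2 haarZ2)]) &
      (* 3 *)
      forall mu : probability (RZ2 R) R,
        Ind Theta mu <->
        exists sigma sigma' beta beta' kappa : R,
          [/\ forall s l,
                chf mu s l = theta_chf sigma sigma' beta beta' kappa s l,
              0 < sigma' < sigma &
              `|kappa| = Num.sqrt (sigma' / sigma) *
                expR (- ((beta - beta') ^+ 2 / (4 * (sigma - sigma'))))]].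
Proof.
split.
- apply/funext => mu; apply/propext; split.
    exact: InfDiv_gauss_convol.
  exact: gauss_convol_InfDiv.
- move=> mu; split=> [I0mu|[]]; last exact: gauss_convol_I0.
  split; first exact: I0_gauss_convol.
  by move=> [gamma [gg ndeg muE]]; exact: (I0_not_gauss_haar gg ndeg muE).
- move=> mu; split; first exact: Ind_theta_law.
  by move=> [s [s' [b [b' [k [law ss' kB]]]]]]; exact: (theta_law_Ind law ss' kB).
Qed.
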